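(* Let $p>1$ and let $f,F$ be real numbers with $f>0$ and $f^p\le F$. Let $c=\omega_p(f^p/F)$ and let $g:(0,1]\to\mathbb{R}^+$ be the function $g(t)=\frac{f}{c}\,t^{-1+\frac1c}$. Let $(g_n)_{n\in\mathbb{N}}$ be a sequence of non-increasing continuous functions $g_n:(0,1]\to\mathbb{R}^+$ such that $\int_0^1 g_n(u)\,du=f$ and $\int_0^1 g_n^p(u)\,du=F$ for every $n\in\mathbb{N}$. Then the following are equivalent: (i) $\displaystyle\lim_{n}\int_0^1\Big(\frac1t\int_0^t g_n(u)\,du\Big)^p dt=F\,\omega_p(f^p/F)^p$; (ii) $\displaystyle\lim_{n}\int_0^1|g_n(t)-g(t)|^p\,dt=0$.
   Context: $\mathbb{R}^+$ denotes the non-negative real numbers. For $p>1$, $\omega_p:[0,1]\to\big[1,\frac{p}{p-1}\big]$ denotes the inverse function $H_p^{-1}$ of $H_p:\big[1,\frac{p}{p-1}\big]\to[0,1]$, $H_p(z)=-(p-1)z^p+pz^{p-1}$ (a strictly decreasing bijection). The function $g$ in the claim is the unique non-increasing continuous function $(0,1]\to\mathbb{R}^+$ with $\int_0^1 g=f$, $\int_0^1 g^p=F$ and $\int_0^1\big(\frac1t\int_0^t g\big)^p dt=F\,\omega_p(f^p/F)^p$. *)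

(* Defs.v *)
From HB Require Import structures.
From mathcomp Require Import all_boot all_order all_algebra.
From mathcomp Require Import all_classical all_reals all_analysis.
Set Implicit Arguments.
Unset Strict Implicit.
Unset Printing Implicit Defensive.
Import Order.TTheory GRing.Theory Num.Theory.
Import numFieldNormedType.Exports.

Local Open Scope classical_set_scope.
Local Open Scope ring_scope.

Definition Hfun (R : realType) (p z : R) : R :=
  - (p - 1) * z `^ p + p * z `^ (p - 1).

(* [pinv] takes an arbitrary value outside the image of [1, p / (p - 1)]
   under [Hfun p], which is [0, 1] when 1 < p. *)
Definition omega (R : realType) (p : R) : R -> R :=
  pinv `[1, p / (p - 1)] (Hfun p).

(* Functions on (0, 1] are functions on R whose values outside ]0, 1] are
   never used. *)
Definition hardy_mean (R : realType) (h : R -> R) (t : R) : R :=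
  t^-1 * \int[@lebesgue_measure R]_(u in `]0, t]) h u.

Definition extremal (R : realType) (p f F : R) (t : R) : R :=
  let c := omega p (f `^ p / F) in f / c * t `^ (- 1 + 1 / c).

(* Main.v *)
(* Write [G] for the Hardy mean of a profile [g], [c = omega p (f `^ p / F)] and
   [D x y = x `^ p + (p - 1) * y `^ p - p * x * y `^ (p - 1)], which is
   nonnegative and vanishes only for [x = y].  Integrating
   [(t * G `^ p)' = p * g * G `^ (p - 1) - (p - 1) * G `^ p] bounds the integral
   of [D (c * g) G] by a multiple of the gap [F * c `^ p - \int G `^ p]; this
   gives Hardy's inequality and, since [D] is coercive, makes [G] close to
   [c * g] in [L^p] when the gap is small.  With [a = (p - 1) * (1 - 1 / c)],
   integrating [(t `^ (1 - a) * G)' = t `^ (- a) * (g - a * G)] then determines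
   the moment [\int t `^ (- a) * g] up to a small error.  As [t `^ (- a)] is
   proportional to the power [p - 1] of the extremal function [g0], this moment
   is what the integral of [D g g0] depends on, so [g] is close to [g0] in [L^p].
   Conversely, if [g] is close to [g0] in [L^p] then the moment is nearly that of
   [g0], and the tangent inequality [D G (c * g0) >= 0] bounds [\int G `^ p] from
   below in terms of the moment of [G], hence of [g]. *)
Require Import Defs.
From HB Require Import structures.
From mathcomp Require Import all_boot all_order all_algebra.
From mathcomp Require Import all_classical all_reals all_analysis.
From mathcomp Require Import measurable_realfun ring lra.
Import Order.TTheory GRing.Theory Num.Theory.
Import numFieldNormedType.Exports.

Local Open Scope classical_set_scope.
Local Open Scope ring_scope.

(** * The Bregman divergence of the power function and its coercivity *)

(** The amount by which the convex function [z^p], evaluated at [x], exceeds its tangent line drawn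
    at [y]. *)
Definition bregman {R : realType} (p x y : R) : R :=
  x `^ p + (p - 1) * y `^ p - p * x * y `^ (p - 1).

(** Young's inequality with exponents [p] and [p / (p - 1)], applied to [x] and [y^(p-1)]. *)
Lemma bregman_ge0 (R : realType) (p x y : R) : 1 < p -> 0 <= x -> 0 <= y ->
  0 <= bregman p x y.
Proof.
move=> p1 x0 y0; have p0 : 0 < p by lra.
have q0 : 0 < p - 1 by lra.
have := @conjugate_powR _ x (y `^ (p - 1)) p (p / (p - 1)) x0 (powR_ge0 _ _) p0
  (divr_gt0 p0 q0).
rewrite -powRrM mulrCA divff ?mulr1 ?gt_eqF// => /(_ _)/wrap[].
  by field; rewrite !gt_eqF.
rewrite -(ler_pM2l p0) /bregman => H.
have E : p * (x `^ p / p + y `^ p / (p / (p - 1))) =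
   x `^ p + (p - 1) * y `^ p by field; rewrite !gt_eqF.
by rewrite E in H; lra.
Qed.

(* Adding the tangent inequalities from [m] to [x] and from [y] to [m], where
   [m] is the midpoint, turns nonnegativity into a quantitative bound. *)
Lemma bregman_ge_midpoint (R : realType) (p x y : R) :
  1 < p -> 0 <= x -> 0 <= y ->
  p / 2 * ((x - y) * (((x + y) / 2) `^ (p - 1) - y `^ (p - 1)))
    <= bregman p x y.
Proof.
move=> p1 x0 y0; set m := (x + y) / 2.
have m0 : 0 <= m by rewrite divr_ge0// addr_ge0.
have p0 : 0 < p by lra.
have := bregman_ge0 R p x m p1 x0 m0; have := bregman_ge0 R p m y p1 m0 y0.
rewrite /bregman -!(@mulr_powRB1 _ m p)// -!(@mulr_powRB1 _ y p)//.
have -> : x = 2 * m - y by rewrite /m; field.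
set M := m `^ _; set Y := y `^ _; set X := _ `^ p => h1 h2.
rewrite -subr_ge0; move: h1 h2.
suff -> : X + (p - 1) * (y * Y) - p * (2 * m - y) * Y -
  p / 2 * ((2 * m - y - y) * (M - Y)) =
  (m * M + (p - 1) * (y * Y) - p * m * Y) +
  (X + (p - 1) * (m * M) - p * (2 * m - y) * M) by move=> *; exact: addr_ge0.
by field.
Qed.

(** When [|x - y|] is at most a small multiple of [y], the term [e * y^p] suffices. Otherwise the
    midpoint differs from [y] by a fixed ratio, and the product in [bregman_ge_midpoint] dominates a
    multiple of [|x - y|^p]. *)
Lemma bregman_coercive (R : realType) (p e : R) : 1 < p -> 0 < e ->
  exists2 K : R, 0 < K & forall x y, 0 <= x -> 0 <= y ->
    `|x - y| `^ p <= e * y `^ p + K * bregman p x y.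
Proof.
move=> p1 e0; have p0 : 0 < p by lra.
have q0 : 0 < p - 1 by lra.
(* The relative threshold: being at most [1] and at most [e], it satisfies [d^p <= e]. *)
pose d : R := Num.min e 1.
have d0 : 0 < d by rewrite lt_min e0 ltr01.
have d1 : d <= 1 by rewrite ge_min lexx orbT.
have de : d `^ p <= e.
  by rewrite (le_trans (@ge1r_powR _ d p _ _)) ?d0 ?(ltW p1)// ge_min lexx.
have nn (x : R) : 0 <= x -> x \is Num.nneg by rewrite nnegrE.
(* With [m] the midpoint, [m^(p-1)] is at least [k1 * y^(p-1)] when [x] exceeds [(1 + d) * y], and
   at most [k2 * y^(p-1)] when [x] is below [(1 - d) * y]. *)
pose k1 := (1 + d / 2) `^ (p - 1); pose k2 := (1 - d / 2) `^ (p - 1).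
have one : (1 : R) `^ (p - 1) = 1 by rewrite powR1.
have k1_gt1 : 1 < k1.
  by rewrite -[ltLHS]one gt0_ltr_powR ?nn//; lra.
have k2_lt1 : k2 < 1.
  by rewrite -[ltRHS]one gt0_ltr_powR ?nn//; lra.
(* This factor comes from [m >= (x - y) / 2] in the case [y <= x]. *)
pose h := (2^-1 : R) `^ (p - 1).
have k1_gt0 : 0 < k1 by exact: lt_trans k1_gt1.
have h0 : 0 < h by rewrite powR_gt0//; lra.
pose C1 := p / 2 * (1 - k1^-1) * h; pose C2 := p / 2 * (1 - k2).
have C1_gt0 : 0 < C1.
  by rewrite /C1 !mulr_gt0// ?subr_gt0 ?invf_lt1//; lra.
have C2_gt0 : 0 < C2 by rewrite /C2 !mulr_gt0 ?subr_gt0//; lra.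
have K1 : 0 <= C1^-1 by rewrite invr_ge0 ltW.
have K2 : 0 <= C2^-1 by rewrite invr_ge0 ltW.
exists (C1^-1 + C2^-1); first by rewrite addr_gt0 ?invr_gt0.
move=> x y x0 y0.
have D0 : 0 <= bregman p x y by exact: bregman_ge0.
have Y0 : 0 <= y `^ (p - 1) by exact: powR_ge0.
have ey : 0 <= e * y `^ p by rewrite mulr_ge0 ?powR_ge0// ltW.
have KD := mulr_ge0 (addr_ge0 K1 K2) D0.
have := bregman_ge_midpoint R p x y p1 x0 y0.
set m := (x + y) / 2 => mid.
have [xy|xy] := leP `|x - y| (d * y).
  have : `|x - y| `^ p <= (d * y) `^ p.
    by rewrite ge0_ler_powR ?(ltW p0) ?nn// mulr_ge0// ltW.
  rewrite powRM ?(ltW d0)// => h1.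
  have := ler_wpM2r (powR_ge0 y p) de; lra.
suff [] : `|x - y| `^ p <= C1^-1 * bregman p x y \/
  `|x - y| `^ p <= C2^-1 * bregman p x y.
- by move=> H; have := mulr_ge0 K2 D0; lra.
- by move=> H; have := mulr_ge0 K1 D0; lra.
have dy0 : 0 <= d * y by rewrite mulr_ge0 // ltW.
have [yx|yx] := leP y x; [left|right].
- move: xy; rewrite ger0_norm ?subr_ge0// => xy.
  rewrite -(ler_pM2l C1_gt0) mulrA divff ?gt_eqF// mul1r.
  apply: le_trans mid; rewrite /C1 -(@mulr_powRB1 _ (x - y) p) ?subr_ge0//.
  have m0 : 0 <= m by rewrite /m; lra.
  have Mge : h * (x - y) `^ (p - 1) <= m `^ (p - 1).
    rewrite /h -powRM ?subr_ge0 ?invr_ge0 ?ler0n//.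
    by rewrite ge0_ler_powR ?(ltW q0) ?nn//; rewrite ?/m; lra.
  have Yle : y `^ (p - 1) <= k1^-1 * m `^ (p - 1).
    rewrite -(@ler_pM2l _ k1) ?(lt_trans ltr01)// mulrA divff ?mul1r; last first.
      by rewrite gt_eqF// (lt_trans ltr01).
    rewrite /k1 -powRM//; last by lra.
    rewrite ge0_ler_powR ?(ltW q0) ?nn//; rewrite ?/m; last by lra.
    by rewrite mulr_ge0//; lra.
  have : (1 - k1^-1) * (h * (x - y) `^ (p - 1)) <= m `^ (p - 1) - y `^ (p - 1).
    apply: (@le_trans _ _ ((1 - k1^-1) * m `^ (p - 1))); last by lra.
    by rewrite ler_wpM2l ?powR_ge0// subr_ge0 invf_le1 ?ltW.
  set Q := (x - y) `^ (p - 1).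
  move=> H; have xy0 : 0 <= p / 2 * (x - y) by rewrite mulr_ge0//; lra.
  have := ler_wpM2l xy0 H.
  by rewrite -!mulrA; congr (_ <= _); ring.
- move: xy; rewrite ltr0_norm ?subr_lt0// opprB => xy.
  rewrite -(ler_pM2l C2_gt0) mulrA divff ?gt_eqF// mul1r.
  apply: le_trans mid; rewrite /C2 -(@mulr_powRB1 _ (y - x) p)//; last by lra.
  have m0 : 0 <= m by rewrite /m; lra.
  have Mle : m `^ (p - 1) <= k2 * y `^ (p - 1).
    rewrite /k2 -powRM//; last by lra.
    rewrite ge0_ler_powR ?(ltW q0) ?nn//; rewrite ?/m; last by lra.
    by rewrite mulr_ge0//; lra.
  have Yge : (y - x) `^ (p - 1) <= y `^ (p - 1).
    by rewrite ge0_ler_powR ?(ltW q0) ?nn//; lra.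
  have H : (1 - k2) * (y - x) `^ (p - 1) <= y `^ (p - 1) - m `^ (p - 1).
    apply: (@le_trans _ _ ((1 - k2) * y `^ (p - 1))); last by lra.
    by rewrite ler_wpM2l ?powR_ge0// subr_ge0 ltW.
  have xy0 : 0 <= p / 2 * (y - x) by rewrite mulr_ge0//; lra.
  have := ler_wpM2l xy0 H.
  by rewrite -!mulrA; congr (_ <= _); ring.
Qed.

(** A Young-type inequality whose coefficient of [v^p] can be made arbitrarily small. For
    [h <= e * v] the first term dominates; otherwise [v] is below [h / e] and the second one
    does. *)
Lemma powRB1_mul_le (R : realType) (p e v h : R) : 1 < p -> 0 < e ->
  0 <= v -> 0 <= h -> v `^ (p - 1) * h <= e * v `^ p + e `^ (1 - p) * h `^ p.
Proof.
move=> p1 e0 v0 h0.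
have p0 : 0 < p by lra.
have V0 : 0 <= e * v `^ p by rewrite mulr_ge0 ?powR_ge0// ltW.
have H0 : 0 <= e `^ (1 - p) * h `^ p by rewrite mulr_ge0 ?powR_ge0.
have [hv|hv] := leP h (e * v).
  have := ler_wpM2l (powR_ge0 v (p - 1)) hv.
  rewrite -(@mulr_powRB1 _ v p)// in V0 *; lra.
have -> : e `^ (1 - p) = (e^-1) `^ (p - 1).
  by rewrite -(powR_inv1 (ltW e0)) -powRrM mulN1r opprB.
have ie0 : 0 <= e^-1 by rewrite invr_ge0 ltW.
have : v `^ (p - 1) <= (e^-1 * h) `^ (p - 1).
  rewrite ge0_ler_powR ?nnegrE ?mulr_ge0//; first by lra.
  by rewrite ltW// mulrC ltr_pdivlMr// mulrC.
rewrite powRM// => /(ler_wpM2r h0).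
rewrite -(@mulr_powRB1 _ h p)//; lra.
Qed.

(** * Integration over the half-open unit interval *)

(** Monotone convergence along the intervals [[1 / (n + 1), 1]]. Integrands singular at [0] can then
    be treated by the fundamental theorem of calculus on [[e, 1]], with a bound uniform in [e]. *)
Lemma ge0_integral_itv_oc_le (R : realType) (h : R -> R) (C : \bar R) :
  measurable_fun (`]0, 1] : set R) h -> (forall t : R, 0 < t <= 1 -> 0 <= h t) ->
  (forall e : R, 0 < e < 1 ->
    (\int[@lebesgue_measure R]_(t in `[e, 1%R]) (h t)%:E <= C)%E) ->
  (\int[@lebesgue_measure R]_(t in `]0%R, 1%R]) (h t)%:E <= C)%E.
Proof.
move=> mh h0 hC.
pose I (n : nat) : set R := `[0 + n.+1%:R^-1, 1]%classic.
have I01 n : I n `<=` `]0, 1].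
  move=> x; rewrite /I /= !in_itv/= add0r => /andP[nx ->]; rewrite andbT.
  by rewrite (lt_le_trans _ nx)// invr_gt0 ltr0n.
rewrite (itv_open_bnd_bigcup false 1 0) -/I.
have /cvge_to_le : (\int[@lebesgue_measure R]_(t in I i) (h t)%:E @[i --> \oo]
    --> \int[@lebesgue_measure R]_(t in \bigcup_i I i) (h t)%:E)%E.
  apply: ge0_nondecreasing_set_cvg_integral => //.
  - move=> m n mn; apply/subsetPset => x; rewrite /I /= !in_itv/= !add0r.
    move=> /andP[mx ->]; rewrite andbT (le_trans _ mx)// lef_pV2 ?posrE ?ltr0n//.
    by rewrite ler_nat.
  - by move=> i; exact: measurable_itv.
  - move=> i; apply/measurable_EFinP; exact: (measurable_funS _ (I01 i)).
  - by move=> i x /I01/=; rewrite in_itv/= => xI; rewrite lee_fin h0.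
(* The bound is available for [e < 1], which excludes [n = 0]. *)
apply; near=> n; apply: hC; rewrite add0r invr_gt0 ltr0n/= invf_lt1 ?ltr0n//.
by rewrite ltr1n; near: n; exists 1%N.
Unshelve. all: by end_near. Qed.

(** Subtracted terms are moved to the other side, so that all integrands are nonnegative and the
    inequality makes sense between possibly infinite integrals. *)
Lemma ge0_integral_le_lin d (T : measurableType d) (R : realType)
    (mu : {measure set T -> \bar R}) (D : set T) (a b c : R)
    (u1 u2 v1 v2 : T -> R) : measurable D -> 0 <= a -> 0 <= b -> 0 <= c ->
  measurable_fun D u1 -> measurable_fun D u2 ->
  measurable_fun D v1 -> measurable_fun D v2 ->
  (forall x, D x -> 0 <= u1 x) -> (forall x, D x -> 0 <= u2 x) ->
  (forall x, D x -> 0 <= v1 x) -> (forall x, D x -> 0 <= v2 x) ->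
  (forall x, D x -> u1 x + a * u2 x <= b * v1 x + c * v2 x) ->
  (\int[mu]_(x in D) (u1 x)%:E + a%:E * \int[mu]_(x in D) (u2 x)%:E
    <= b%:E * \int[mu]_(x in D) (v1 x)%:E + c%:E * \int[mu]_(x in D) (v2 x)%:E)%E.
Proof.
move=> mD a0 b0 c0 mu1 mu2 mv1 mv2 u10 u20 v10 v20 uv.
have mZ k (w : T -> R) : measurable_fun D w ->
    measurable_fun D (fun x => k%:E * (w x)%:E)%E.
  move=> mw; under eq_fun do rewrite -EFinM.
  by apply/measurable_EFinP; exact: measurable_funM.
have mE (w : T -> R) : measurable_fun D w -> measurable_fun D (fun x => (w x)%:E).
  by move=> mw; exact/measurable_EFinP.
have zZ k (w : T -> R) : 0 <= k -> (forall x, D x -> 0 <= w x) ->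
    forall x, D x -> (0 <= k%:E * (w x)%:E)%E.
  by move=> k0 w0 x Dx; rewrite -EFinM lee_fin mulr_ge0// w0.
rewrite -!ge0_integralZl_EFin//; [|exact: mE..].
rewrite -!ge0_integralD//; do ?[exact: zZ|exact: mZ|exact: mE].
apply: ge0_le_integral => //.
- by move=> x Dx; rewrite -EFinM -EFinD lee_fin addr_ge0 ?mulr_ge0 ?u10 ?u20.
- by apply: emeasurable_funD; do ?[exact: mE|exact: mZ].
- by apply: emeasurable_funD; do ?exact: mZ.
Qed.

Lemma FTC2_itv_oc (R : realType) (F f : R -> R) :
  (forall t : R, 0 < t < 1 -> is_derive t 1 F (f t)) ->
  {within `]0, 1], continuous F} -> {within `]0, 1], continuous f} ->
  forall e : R, 0 < e < 1 ->
  (\int[@lebesgue_measure R]_(t in `[e, 1%R]) (f t)%:E = (F 1 - F e)%:E)%E.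
Proof.
move=> dF cF cf e /andP[e0 e1].
have sub : (`[e, 1] : set R) `<=` `]0, 1].
  by apply: subset_itvr; rewrite bnd_simp.
have t01 t : t \in `]e, 1[ -> 0 < t < 1.
  by rewrite in_itv/= => /andP[et ->]; rewrite (lt_trans e0).
have := continuous_subspaceW sub cF => /(continuous_within_itvP _ e1)[_ Fe F1].
rewrite EFinB (@continuous_FTC2 _ f F e 1)//.
- exact: continuous_subspaceW sub cf.
- split=> // t /t01 /dF Ft; exact: ex_derive.
- by move=> t /t01 /dF Ft; rewrite derive1E derive_val.
Qed.

Lemma Rintegral_itv_oc_continuous (R : realType) (g : R -> R) :
  (@lebesgue_measure R).-integrable (`]0, 1] : set R) (EFin \o g) ->
  {within `]0, 1], continuous
    (fun t => \int[@lebesgue_measure R]_(u in `]0, t]) g u)}.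
Proof.
move=> ig.
have mg : measurable_fun (`]0, 1] : set R) g.
  by case/integrableP : ig => /measurable_EFinP.
have ig' : (@lebesgue_measure R).-integrable `[0, 1] (EFin \o g).
  apply/integrableP; split.
    by apply/measurable_EFinP/measurable_fun_itv_obnd_cbndP.
  rewrite -integral_itv_obnd_cbnd; first by case/integrableP : ig.
  apply/measurable_EFinP; exact: measurableT_comp.
have := parameterized_integral_continuous ler01 ig'.
have sub : (`]0, 1] : set R) `<=` `[0, 1] by exact: subset_itv_oc_cc.
move=> /(continuous_subspaceW sub); rewrite /parameterized_integral.
apply: (@subspace_eq_continuous _ _ R) => t.
rewrite inE/= in_itv/= => /andP[t0 t1].
rewrite /from_subspace/= Rintegral_itv_obnd_cbnd//.
have sub' : (`]0, t] : set R) `<=` `]0, 1].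
  by apply: subset_itvl; rewrite bnd_simp.
by apply: integrableS ig.
Qed.

Lemma is_derive_Rintegral_itv_oc (R : realType) (g : R -> R) :
  (@lebesgue_measure R).-integrable (`]0, 1] : set R) (EFin \o g) ->
  {within `]0, 1], continuous g} -> forall t : R, 0 < t < 1 ->
  is_derive t 1 (fun t => \int[@lebesgue_measure R]_(u in `]0, t]) g u) (g t).
Proof.
move=> ig cg t /andP[t0 t1].
have cgt : {for t, continuous g}.
  have sub : (`]0, 1[ : set R) `<=` `]0, 1] by exact: subset_itv_oo_oc.
  have := continuous_subspaceW sub cg.
  rewrite continuous_open_subspace; last exact: itv_open.
  by apply; rewrite inE/= in_itv/= t0.
have [] := @continuous_FTC1 R g (BRight 0) t 1 t1 ig _ cgt.
  by rewrite lte_fin.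
by rewrite derive1E => dg Dg; apply: DeriveDef.
Qed.

(** * Continuity and measurability on []0, 1]] *)

Lemma powR_continuous_gt0 (R : realType) (r x : R) : 0 < x ->
  {for x, continuous (fun y : R => y `^ r)}.
Proof.
move=> x0; apply/differentiable_continuous/derivable1_diffP.
by apply: derivable_powR; rewrite in_itv/= x0.
Qed.

(** Away from [0] this is a composition; at [0] the function is squeezed between [0] and [|y|]
    because [1 <= p]. *)
Lemma norm_powR_continuous (R : realType) (p : R) : 1 <= p ->
  continuous (fun x : R => `|x| `^ p).
Proof.
move=> p1 x; have [->|x0] := eqVneq x 0; last first.
  apply: (@continuous_comp _ _ _ (fun y : R => `|y|) (@powR R ^~ p)).
    exact: norm_continuous.
  by apply: powR_continuous_gt0; rewrite normr_gt0.
have p0 : p != 0 by rewrite gt_eqF// (lt_le_trans ltr01).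
suff : `|y| `^ p @[y --> (0 : R)] --> (0 : R).
  by rewrite /continuous_at normr0 powR0.
apply: (@squeeze_cvgr _ _ _ _ (cst 0) (fun y : R => `|y|)).
- near=> y; rewrite powR_ge0/=.
  have [->|y0] := eqVneq y 0; first by rewrite normr0 powR0.
  rewrite ge1r_powR// normr_gt0 y0/=.
  by near: y; exact: (@nbhs0_le R R 1 ltr01).
- exact: cvg_cst.
- by rewrite -[X in _ --> X](@normr0 _ R); exact: norm_continuous.
Unshelve. all: by end_near. Qed.

Lemma within_continuousP (R : realType) (h : R -> R) :
  {within `]0, 1], continuous h} <->
  forall t : R, 0 < t <= 1 -> {for t, continuous (h : subspace `]0, 1] -> R)}.
Proof.
split=> [H t _|H]; first exact: H.
by rewrite continuous_subspace_in => t; rewrite inE/= in_itv/=; exact: H.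
Qed.

Lemma within_powR_id (R : realType) (r : R) :
  {within `]0, 1], continuous (fun t : R => t `^ r)}.
Proof.
apply/within_continuousP => t t01; apply: continuous_subspaceT_for.
  by rewrite /= in_itv.
by apply: powR_continuous_gt0; case/andP: t01.
Qed.

Lemma within_powR_gt0 (R : realType) (r : R) (h : R -> R) :
  (forall t : R, 0 < t <= 1 -> 0 < h t) -> {within `]0, 1], continuous h} ->
  {within `]0, 1], continuous (fun t => h t `^ r)}.
Proof.
move=> h0 /within_continuousP ch; apply/within_continuousP => t t01.
apply: (@continuous_comp _ _ _ (h : subspace `]0, 1] -> R) (@powR R ^~ r)).
  exact: ch.
by apply: powR_continuous_gt0; exact: h0.
Qed.

Lemma within_powR_ge0 (R : realType) (p : R) (h : R -> R) : 1 <= p ->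
  (forall t : R, 0 < t <= 1 -> 0 <= h t) -> {within `]0, 1], continuous h} ->
  {within `]0, 1], continuous (fun t => h t `^ p)}.
Proof.
move=> p1 h0 ch.
have : {within `]0, 1], continuous (fun t => `|h t| `^ p)}.
  move/within_continuousP : ch => ch; apply/within_continuousP => t t01.
  apply: (@continuous_comp _ _ _ (h : subspace `]0, 1] -> R)
    (fun x => `|x| `^ p)); first exact: ch.
  exact: norm_powR_continuous.
apply: (@subspace_eq_continuous _ _ R) => t.
by rewrite inE/= in_itv/= => t01; rewrite /from_subspace/= ger0_norm// h0.
Qed.

Lemma within_continuousM (R : realType) (h k : R -> R) :
  {within `]0, 1], continuous h} -> {within `]0, 1], continuous k} ->
  {within `]0, 1], continuous (fun t => h t * k t)}.
Proof.
move=> ch ck; move=> t.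
by apply: (@continuousM _ _ (h : subspace `]0, 1] -> R)); [exact: ch|exact: ck].
Qed.

Lemma within_continuousD (R : realType) (h k : R -> R) :
  {within `]0, 1], continuous h} -> {within `]0, 1], continuous k} ->
  {within `]0, 1], continuous (fun t => h t + k t)}.
Proof.
move=> ch ck; move=> t.
by apply: (@continuousD _ _ _ (h : subspace `]0, 1] -> R)); [exact: ch|exact: ck].
Qed.

Lemma within_continuousB (R : realType) (h k : R -> R) :
  {within `]0, 1], continuous h} -> {within `]0, 1], continuous k} ->
  {within `]0, 1], continuous (fun t => h t - k t)}.
Proof.
move=> ch ck; move=> t.
by apply: (@continuousB _ _ _ (h : subspace `]0, 1] -> R)); [exact: ch|exact: ck].
Qed.

Lemma within_cst (R : realType) (k : R) :
  {within `]0, 1], continuous (fun _ : R => k)}.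
Proof. by apply: continuous_subspaceT => x; exact: cvg_cst. Qed.

Lemma within_measurable (R : realType) (h : R -> R) :
  {within `]0, 1], continuous h} -> measurable_fun (`]0, 1] : set R) h.
Proof.
by move=> ch; apply: subspace_continuous_measurable_fun => //; exact: measurable_itv.
Qed.

(** * Hardy means and the two integrated derivative identities *)

Lemma mulr_hardy_mean (R : realType) (h : R -> R) (t : R) : 0 < t ->
  t * hardy_mean h t = \int[@lebesgue_measure R]_(u in `]0, t]) h u.
Proof. by move=> t0; rewrite /hardy_mean mulrA divff ?mul1r// gt_eqF. Qed.

Lemma hardy_mean_continuous (R : realType) (h : R -> R) :
  (@lebesgue_measure R).-integrable (`]0, 1] : set R) (EFin \o h) ->
  {within `]0, 1], continuous (hardy_mean h)}.
Proof.
move=> ih; apply: within_continuousM.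
  apply/within_continuousP => t t01; apply: continuous_subspaceT_for.
    by rewrite /= in_itv.
  by apply: inv_continuous; rewrite gt_eqF//; case/andP: t01.
exact: Rintegral_itv_oc_continuous.
Qed.

Lemma integral_EFin d (T : measurableType d) (R : realType)
    (mu : {measure set T -> \bar R}) (D : set T) (h : T -> R) :
  measurable D -> mu.-integrable D (EFin \o h) ->
  (\int[mu]_(x in D) (h x)%:E = (\int[mu]_(x in D) h x)%R%:E)%E.
Proof. by move=> mD ih; rewrite /Rintegral fineK//; exact: integrable_fin_num. Qed.

(** Jensen's inequality: the tangent inequality for [h u] at the mean [m] is integrated over []0,
    e]]. It controls the boundary term near [0] in [hardy_deficit_le]. *)
Lemma hardy_mean_powR_le (R : realType) (p e : R) (h : R -> R) :
  1 < p -> 0 < e <= 1 -> (forall t : R, 0 < t <= 1 -> 0 <= h t) ->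
  (@lebesgue_measure R).-integrable (`]0, 1] : set R) (EFin \o h) ->
  (@lebesgue_measure R).-integrable (`]0, 1] : set R)
    (EFin \o (fun t => h t `^ p)) ->
  e * hardy_mean h e `^ p
    <= \int[@lebesgue_measure R]_(u in `]0, e]) (h u `^ p).
Proof.
move=> p1 /andP[e0 e1] h0 ih ihp.
have sub : (`]0, e] : set R) `<=` `]0, 1].
  by apply: subset_itvl; rewrite bnd_simp.
have ih' : (@lebesgue_measure R).-integrable (`]0, e] : set R) (EFin \o h).
  by apply: integrableS ih.
have ihp' : (@lebesgue_measure R).-integrable (`]0, e] : set R)
    (EFin \o (fun t => h t `^ p)) by apply: integrableS ihp.
have h0' (t : R) : t \in `]0, e] -> 0 <= h t.
  by rewrite in_itv/= => /andP[t0 te]; rewrite h0// t0 (le_trans te).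
have mh : measurable_fun (`]0, e] : set R) h.
  by case/integrableP : ih' => /measurable_EFinP.
have mhp : measurable_fun (`]0, e] : set R) (fun t => h t `^ p).
  by case/integrableP : ihp' => /measurable_EFinP.
set m := hardy_mean h e; have m0 : 0 <= m.
  rewrite /m /hardy_mean mulr_ge0 ?invr_ge0 ?(ltW e0)//.
  by apply: Rintegral_ge0 => t /h0'.
have p0 : 0 <= p - 1 by lra.
have pm0 : 0 <= p * m `^ (p - 1) by rewrite mulr_ge0 ?powR_ge0//; lra.
have mm0 : 0 <= (p - 1) * m `^ p by rewrite mulr_ge0 ?powR_ge0//; lra.
have me : (\int[@lebesgue_measure R]_(u in `]0%R, e]) (1%R)%:E = e%:E)%E.
  by rewrite integral_cst//= lebesgue_measure_itv/= lte_fin e0 mul1e oppr0 adde0.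
have := @ge0_integral_le_lin _ _ _ (@lebesgue_measure R) (`]0, e] : set R)
  (p * m `^ (p - 1)) 1 ((p - 1) * m `^ p) (cst 0) h (fun t => h t `^ p) (cst 1)
  (measurable_itv _) pm0 ler01 mm0 (measurable_cst _) mh mhp (measurable_cst _)
  (fun _ _ => lexx _) h0' (fun _ _ => powR_ge0 _ _) (fun _ _ => ler01).
rewrite [X in (X + _ <= _)%E]integral0 add0e me !integral_EFin//= => /(_ _)/wrap[].
  move=> t te; have := @bregman_ge0 _ p (h t) m p1 (h0' _ te) m0.
  rewrite /bregman; lra.
rewrite -(mulr_hardy_mean _ h e e0) -/m.
rewrite -!EFinM -!EFinD lee_fin -(@mulr_powRB1 _ m p)//; last by lra.
set B := Rintegral _ _ _; set M := m `^ _; nra.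
Qed.

Lemma is_derive_powR_comp (R : realType) (r t dh : R) (h : R -> R) :
  0 < h t -> is_derive t 1 h dh ->
  is_derive t 1 (fun u => h u `^ r) (r * h t `^ (r - 1) * dh).
Proof.
move=> ht hd; apply: (@is_derive1_comp _ (@powR R ^~ r) h) => //.
exact: is_derive1_powR.
Qed.

(* The integrand is the derivative of
   [s `^ p * \int_(u in `]0, t]) h u `^ p - s * (t * hardy_mean h t `^ p)]. *)
Lemma hardy_deficit_le (R : realType) (p s : R) (h : R -> R) :
  1 < p -> 1 <= s -> (forall t : R, 0 < t <= 1 -> 0 <= h t) ->
  {within `]0, 1], continuous h} ->
  (@lebesgue_measure R).-integrable (`]0, 1] : set R) (EFin \o h) ->
  (@lebesgue_measure R).-integrable (`]0, 1] : set R)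
    (EFin \o (fun t => h t `^ p)) ->
  (forall t : R, 0 < t <= 1 -> 0 < hardy_mean h t) ->
  (\int[@lebesgue_measure R]_(t in `]0%R, 1%R])
     (s `^ p * h t `^ p + (p - 1) * s * hardy_mean h t `^ p
       - p * s * h t * hardy_mean h t `^ (p - 1))%:E
   <= (s `^ p * (\int[@lebesgue_measure R]_(u in `]0%R, 1%R]) h u `^ p)%R
       - s * hardy_mean h 1 `^ p)%:E)%E.
Proof.
move=> p1 s1 h0 ch ih ihp G0; set G := hardy_mean h.
have s0 : 0 < s by lra.
pose A t := \int[@lebesgue_measure R]_(u in `]0, t]) h u.
pose B t := \int[@lebesgue_measure R]_(u in `]0, t]) (h u `^ p).
have AE t : 0 < t -> A t = t * G t by move=> t0; rewrite mulr_hardy_mean.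
have A0 t : 0 < t <= 1 -> 0 < A t.
  by move=> /[dup] /andP[t0 _] t01; rewrite AE// mulr_gt0// G0.
pose Q t := s `^ p * h t `^ p + (p - 1) * s * G t `^ p
  - p * s * h t * G t `^ (p - 1).
(* The term [t * G^p] is written as [t^(1-p) * A^p], so that differentiating it only involves the
   primitive [A]. *)
pose Phi t := s `^ p * B t - s * (t `^ (1 - p) * A t `^ p).
have cG : {within `]0, 1], continuous G} by exact: hardy_mean_continuous.
have chp : {within `]0, 1], continuous (fun t => h t `^ p)}.
  by apply: within_powR_ge0 => //; exact: ltW.
have cGr r : {within `]0, 1], continuous (fun t => G t `^ r)}.
  by apply: within_powR_gt0.
have cQ : {within `]0, 1], continuous Q}.
  apply: within_continuousB; last first.
    apply: within_continuousM => //; apply: within_continuousM => //.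
    exact: within_cst.
  by apply: within_continuousD; apply: within_continuousM => //;
    exact: within_cst.
have cPhi : {within `]0, 1], continuous Phi}.
  apply: within_continuousB; apply: within_continuousM; try exact: within_cst.
    exact: Rintegral_itv_oc_continuous.
  apply: within_continuousM; first exact: within_powR_id.
  by apply: within_powR_gt0 => //; exact: Rintegral_itv_oc_continuous.
have Apow (t r : R) : 0 < t <= 1 -> A t `^ r = t `^ r * G t `^ r.
  move=> /[dup] /andP[t0 _] t01.
  by rewrite AE// (@powRM _ t (G t)) ?(ltW t0) ?(ltW (G0 _ _)).
have tG (t : R) : 0 < t <= 1 -> t `^ (1 - p) * A t `^ p = t * G t `^ p.
  move=> /[dup] /andP[t0 _] t01; rewrite Apow// mulrA; congr (_ * _).
  rewrite -powRD; last by rewrite (gt_eqF t0) implybT.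
  by rewrite subrK powRr1 ?(ltW t0).
have dPhi (t : R) : 0 < t < 1 -> is_derive t 1 Phi (Q t).
  move=> /andP[t0 t1].
  have t01 : 0 < t <= 1 by rewrite t0 ltW.
  have At0 : 0 < A t by rewrite A0.
  have dA : is_derive t 1 A (h t).
    by apply: is_derive_Rintegral_itv_oc => //; rewrite t0.
  have dB : is_derive t 1 B (h t `^ p).
    by apply: (@is_derive_Rintegral_itv_oc _ (fun t => h t `^ p)) => //;
      rewrite t0.
  have dAp := @is_derive_powR_comp _ p t _ A At0 dA.
  have dt := is_derive1_powR (1 - p) t0.
  have D1 := is_deriveZ (s `^ p) dB.
  have D2 := is_deriveZ s (is_deriveM dt dAp).
  apply: (is_derive_eq (is_deriveB D1 D2)).
  rewrite /Q /GRing.scale /=.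
  have -> : G t `^ p = t `^ (1 - p - 1) * A t `^ p.
    rewrite Apow// mulrA -powRD; last by rewrite (gt_eqF t0) implybT.
    by rewrite addrAC subrK subrr powRr0 mul1r.
  have -> : G t `^ (p - 1) = t `^ (1 - p) * A t `^ (p - 1).
    rewrite Apow// mulrA -powRD; last by rewrite (gt_eqF t0) implybT.
    by rewrite addrA subrK subrr powRr0 mul1r.
  ring.
apply: ge0_integral_itv_oc_le; first exact: within_measurable.
  (* The integrand is [bregman p (s * h t) (G t)] plus [(p - 1) * (s - 1) * G^p], and both are
     nonnegative since [1 <= s]. *)
  move=> t t01; have Gt0 := ltW (G0 t t01).
  have := @bregman_ge0 _ p (s * h t) (G t) p1 (mulr_ge0 (ltW s0) (h0 t t01)) Gt0.
  rewrite /bregman powRM ?(ltW s0) ?h0// /Q.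
  have : 0 <= (p - 1) * (s - 1) * G t `^ p.
    by rewrite !mulr_ge0 ?powR_ge0//; lra.
  lra.
move=> e e01; rewrite (FTC2_itv_oc _ Phi Q dPhi cPhi cQ e e01) lee_fin.
have [e0 e1] := andP e01.
have e01' : 0 < e <= 1 by rewrite e0 ltW.
rewrite /Phi (tG _ e01') (tG 1) ?ltr01 ?lexx// mul1r.
have := @hardy_mean_powR_le _ p e h p1 e01' h0 ih ihp; rewrite -/(B e) -/G => J.
have s1p : s <= s `^ p by rewrite le1r_powR// ltW.
have eG0 : 0 <= e * G e `^ p by rewrite mulr_ge0 ?powR_ge0// ltW.
by rewrite -/(B 1) gerBl subr_ge0; exact: ler_pM (ltW s0) eG0 s1p J.
Qed.

(* The integrand is the derivative of
   [\int_(u in `]0, t]) (u `^ (- a) * h u) - t `^ (- a) * (t * hardy_mean h t)],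
   which is nonnegative because [t `^ (- a) <= u `^ (- a)] for [u <= t]. *)
Lemma integral_weighted_hardy_mean (R : realType) (a : R) (h : R -> R) :
  0 <= a -> (forall t : R, 0 < t <= 1 -> 0 <= h t) ->
  {within `]0, 1], continuous h} ->
  (@lebesgue_measure R).-integrable (`]0, 1] : set R) (EFin \o h) ->
  (@lebesgue_measure R).-integrable (`]0, 1] : set R)
    (EFin \o (fun t => t `^ (- a) * h t)) ->
  (\int[@lebesgue_measure R]_(t in `]0%R, 1%R])
      (a * (t `^ (- a) * hardy_mean h t))%:E
   = ((\int[@lebesgue_measure R]_(t in `]0%R, 1%R]) (t `^ (- a) * h t))%R
       - hardy_mean h 1)%:E)%E.
Proof.
move=> a0 h0 ch ih iwh; set G := hardy_mean h.
pose w (t : R) := t `^ (- a) * h t.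
pose A t := \int[@lebesgue_measure R]_(u in `]0, t]) h u.
pose M t := \int[@lebesgue_measure R]_(u in `]0, t]) (u `^ (- a) * h u).
pose Q t := a * (t `^ (- a) * G t).
pose Psi t := M t - t `^ (- a) * A t.
have cw : {within `]0, 1], continuous (fun t => t `^ (- a) * h t)}.
  by apply: within_continuousM => //; exact: within_powR_id.
have cM : {within `]0, 1], continuous M} by exact: Rintegral_itv_oc_continuous.
have cA : {within `]0, 1], continuous A} by exact: Rintegral_itv_oc_continuous.
have cQ : {within `]0, 1], continuous Q}.
  apply: within_continuousM; first exact: within_cst.
  apply: within_continuousM; first exact: within_powR_id.
  exact: hardy_mean_continuous.
have cPsi : {within `]0, 1], continuous Psi}.
  apply: within_continuousB => //.
  by apply: within_continuousM => //; exact: within_powR_id.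
have dM (t : R) : 0 < t < 1 -> is_derive t 1 M (w t).
  exact: (@is_derive_Rintegral_itv_oc _ (fun t => t `^ (- a) * h t)).
have dPsi (t : R) : 0 < t < 1 -> is_derive t 1 Psi (Q t).
  move=> /[dup] t01 /andP[t0 _].
  have dA : is_derive t 1 A (h t) by exact: is_derive_Rintegral_itv_oc.
  have dt := is_derive1_powR (- a) t0.
  apply: (is_derive_eq (is_deriveB (dM t t01) (is_deriveM dt dA))).
  rewrite /w /Q /GRing.scale /= /A -(mulr_hardy_mean _ h t t0) -/G.
  have -> : t `^ (- a) = t * t `^ (- a - 1).
    rewrite -[X in X * _]powRr1 ?(ltW t0)// -powRD; last first.
      by rewrite (gt_eqF t0) implybT.
    by rewrite addrC subrK.
  ring.
have Gge0 (t : R) : 0 < t <= 1 -> 0 <= G t.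
  move=> /andP[t0 t1]; rewrite mulr_ge0 ?invr_ge0 ?(ltW t0)//.
  apply: Rintegral_ge0 => u /=; rewrite in_itv/= => /andP[u0 ut].
  by rewrite h0// u0 (le_trans ut).
have Q0 (t : R) : 0 < t <= 1 -> 0 <= Q t.
  by move=> t01; rewrite mulr_ge0// mulr_ge0 ?powR_ge0 ?Gge0.
have w0 (t : R) : 0 < t <= 1 -> 0 <= w t.
  by move=> t01; rewrite mulr_ge0 ?powR_ge0 ?h0.
have A1 : A 1 = G 1 by rewrite /G /hardy_mean invr1 mul1r.
have Psi1 : Psi 1 = M 1 - G 1 by rewrite /Psi powR1 mul1r A1.
apply/eqP; rewrite eq_le; apply/andP; split.
(* Upper bound: the integral over [[e, 1]] is [Psi 1 - Psi e], and [Psi e] is nonnegative. *)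
- apply: ge0_integral_itv_oc_le => //; first exact: within_measurable.
  move=> e e01; rewrite (FTC2_itv_oc _ Psi Q dPsi cPsi cQ e e01) lee_fin Psi1.
  rewrite lerBlDr lerDl subr_ge0 /A -/(M e).
  have [e0 e1] := andP e01.
  have sub : (`]0, e] : set R) `<=` `]0, 1].
    by apply: subset_itvl; rewrite bnd_simp ltW.
  have ih' : (@lebesgue_measure R).-integrable (`]0, e] : set R) (EFin \o h).
    by apply: integrableS ih.
  rewrite -RintegralZl//; apply: le_Rintegral => //.
  + under [EFin \o _]eq_fun do rewrite /= EFinM.
    exact: integrableZl.
  + by apply: integrableS iwh.
  move=> u /=; rewrite in_itv/= => /andP[u0 ue].
  rewrite ler_wpM2r ?h0 ?u0 ?(le_trans ue (ltW e1))//.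
  rewrite !powRN lef_pV2 ?posrE ?powR_gt0//.
  by rewrite ge0_ler_powR ?nnegrE ?(ltW u0) ?(ltW e0).
- set N := integral _ _ _.
  have N0 : (0 <= N)%E.
    by apply: integral_ge0 => t /=; rewrite in_itv/= lee_fin => /Q0.
  (* Lower bound: [M 1 - M e] is at most [Psi 1 - Psi e + G 1], hence at most [N + G 1], because
     [e^(-a) * A e] is nonnegative. The limit of that boundary term is thus never computed. *)
  have : (\int[@lebesgue_measure R]_(t in `]0%R, 1%R]) (w t)%:E
      <= N + (G 1)%:E)%E.
    apply: ge0_integral_itv_oc_le => //; first exact: within_measurable.
    move=> e e01; have [e0 e1] := andP e01.
    have Ae0 : 0 <= e `^ (- a) * A e.
      rewrite mulr_ge0 ?powR_ge0// -[A e](mulr_hardy_mean _ h e e0).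
      by rewrite mulr_ge0 ?Gge0 ?e0 ?(ltW e0) ?(ltW e1).
    have sub : (`[e, 1] : set R) `<=` `]0, 1].
      by apply: subset_itvr; rewrite bnd_simp.
    have : (\int[@lebesgue_measure R]_(t in `[e, 1%R]) (Q t)%:E <= N)%E.
      apply: ge0_subset_integral => //; try exact: measurable_itv.
      by apply/measurable_EFinP; exact: within_measurable.
    rewrite (FTC2_itv_oc _ Psi Q dPsi cPsi cQ e e01).
    rewrite (FTC2_itv_oc _ M w dM cM cw e e01) => H.
    apply: (@le_trans _ _ ((Psi 1 - Psi e)%:E + (G 1)%:E)%E); last first.
      by rewrite leeD2r.
    by rewrite -EFinD lee_fin Psi1 /Psi; lra.
  rewrite (integral_EFin _ _ _ (@lebesgue_measure R)) // EFinB.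
  by rewrite leeBlDr.
Qed.

Lemma integral_powRN (R : realType) (b : R) : b < 1 ->
  (\int[@lebesgue_measure R]_(t in `]0%R, 1%R]) (t `^ (- b))%:E
    = ((1 - b)^-1)%:E)%E.
Proof.
move=> b1; have b0 : 0 < 1 - b by rewrite subr_gt0.
have c0 : (1 - b)^-1 * (1 - b) = 1 by rewrite mulVf// gt_eqF.
pose F (t : R) := (1 - b)^-1 * t `^ (1 - b).
pose f (t : R) := t `^ (- b).
have cf : {within `]0, 1], continuous f} by exact: within_powR_id.
have cF : {within `]0, 1], continuous F}.
  by apply: within_continuousM; [exact: within_cst|exact: within_powR_id].
have dF (t : R) : 0 < t < 1 -> is_derive t 1 F (f t).
  move=> /andP[t0 _]; have dt := is_derive1_powR (1 - b) t0.
  apply: (is_derive_eq (is_deriveZ (1 - b)^-1 dt)).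
  by rewrite /GRing.scale/= mulrA c0 mul1r /f; congr (_ `^ _); ring.
have F1 : F 1 = (1 - b)^-1 by rewrite /F powR1 mulr1.
apply/eqP; rewrite eq_le; apply/andP; split.
- apply: ge0_integral_itv_oc_le => //; first exact: within_measurable.
    by move=> t _; exact: powR_ge0.
  move=> e e01; rewrite (FTC2_itv_oc _ F f dF cF cf e e01) lee_fin F1.
  by rewrite lerBlDr lerDl mulr_ge0 ?powR_ge0// invr_ge0 ltW.
- set N := integral _ _ _.
  have : (F 1 - F e)%:E @[e --> 0^'+] --> ((1 - b)^-1)%:E.
    apply: cvg_EFin; first exact: nearW.
    rewrite -[X in _ --> X]subr0 F1; apply: cvgB; first exact: cvg_cst.
    rewrite -[X in _ --> X](mulr0 (1 - b)^-1); apply: cvgM; first exact: cvg_cst.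
    exact: powR_cvg0.
  move=> /cvge_to_le; apply; near=> e.
  have e01 : 0 < e < 1.
    apply/andP; split; near: e; [exact: nbhs_right_gt|exact: nbhs_right_lt].
  rewrite -(FTC2_itv_oc _ F f dF cF cf e e01).
  apply: ge0_subset_integral => //; try exact: measurable_itv.
  + by apply/measurable_EFinP; exact: within_measurable.
  + by move=> t _; rewrite lee_fin powR_ge0.
  + by apply: subset_itvr; rewrite bnd_simp; case/andP: e01.
Unshelve. all: by end_near. Qed.

(** Turns a pointwise linear inequality into a numerical one once the integrals are bounded by real
    numbers. Shorter inequalities fill a slot with [cst 0]; taking [u1] to be [cst 0] yields an
    inequality between the bounds themselves. *)
Lemma unit_integral_le (R : realType) (a b c x y z : R) (u1 u2 v1 v2 : R -> R) :
  0 <= a -> 0 <= b -> 0 <= c ->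
  measurable_fun (`]0, 1] : set R) u1 -> measurable_fun (`]0, 1] : set R) u2 ->
  measurable_fun (`]0, 1] : set R) v1 -> measurable_fun (`]0, 1] : set R) v2 ->
  (forall t : R, 0 < t <= 1 -> [/\ 0 <= u1 t, 0 <= u2 t, 0 <= v1 t & 0 <= v2 t]) ->
  (forall t : R, 0 < t <= 1 -> u1 t + a * u2 t <= b * v1 t + c * v2 t) ->
  (z%:E <= \int[@lebesgue_measure R]_(t in `]0%R, 1%R]) (u2 t)%:E)%E ->
  (\int[@lebesgue_measure R]_(t in `]0%R, 1%R]) (v1 t)%:E <= x%:E)%E ->
  (\int[@lebesgue_measure R]_(t in `]0%R, 1%R]) (v2 t)%:E <= y%:E)%E ->
  (\int[@lebesgue_measure R]_(t in `]0%R, 1%R]) (u1 t)%:E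
    <= (b * x + c * y - a * z)%:E)%E.
Proof.
move=> a0 b0 c0 mu1 mu2 mv1 mv2 pos le_uv zu vx vy.
have D t : t \in (`]0, 1] : interval R) -> 0 < t <= 1 by rewrite in_itv.
have := @ge0_integral_le_lin _ _ _ (@lebesgue_measure R) (`]0, 1] : set R)
  a b c u1 u2 v1 v2 (measurable_itv _) a0 b0 c0 mu1 mu2 mv1 mv2.
move=> /(_ _ _ _ _ _)/wrap[|||||].
- by move=> t /D /pos[].
- by move=> t /D /pos[].
- by move=> t /D /pos[].
- by move=> t /D /pos[].
- by move=> t /D /le_uv.
move=> H; rewrite EFinB leeBrDr//.
apply: le_trans; last first.
  apply: (le_trans H); rewrite EFinD !EFinM; apply: leeD.
    by apply: lee_wpmul2l; rewrite ?lee_fin.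
  by apply: lee_wpmul2l; rewrite ?lee_fin.
by rewrite EFinM; apply: leeD2l; apply: lee_wpmul2l; rewrite ?lee_fin.
Qed.

Lemma ge0_integrable_itv_oc (R : realType) (C : R) (h : R -> R) :
  measurable_fun (`]0, 1] : set R) h ->
  (forall t : R, 0 < t <= 1 -> 0 <= h t) ->
  (\int[@lebesgue_measure R]_(t in `]0%R, 1%R]) (h t)%:E <= C%:E)%E ->
  (@lebesgue_measure R).-integrable (`]0, 1] : set R) (EFin \o h).
Proof.
move=> mh h0 hC; apply/integrableP; split; first exact/measurable_EFinP.
apply: le_lt_trans (ltry C); apply: le_trans hC.
rewrite le_eqVlt; apply/orP; left; apply/eqP; apply: eq_integral.
by move=> t; rewrite inE/= in_itv/= => t01; rewrite /= ger0_norm// h0.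
Qed.

(** * Monotone profiles and their Hardy means *)

Definition monotone_profile {R : realType} (p f F : R) (g : R -> R) : Prop :=
  [/\ forall t : R, 0 < t <= 1 -> 0 <= g t,
      forall s t : R, 0 < s -> s <= t -> t <= 1 -> g t <= g s,
      {within `]0, 1], continuous g},
      (\int[@lebesgue_measure R]_(u in `]0%R, 1%R]) (g u)%:E = f%:E)%E &
      (\int[@lebesgue_measure R]_(u in `]0%R, 1%R]) (g u `^ p)%:E = F%:E)%E].

Lemma profile_integrable (R : realType) (p f F : R) (g : R -> R) :
  monotone_profile p f F g ->
  (@lebesgue_measure R).-integrable (`]0, 1] : set R) (EFin \o g).
Proof.
case=> g0 _ cg ig _; apply: (@ge0_integrable_itv_oc _ f) => //.
  exact: within_measurable.
by rewrite ig.
Qed.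

Lemma profile_measurable (R : realType) (p f F : R) (g : R -> R) :
  monotone_profile p f F g ->
  measurable_fun (`]0, 1] : set R) g /\
  measurable_fun (`]0, 1] : set R) (hardy_mean g).
Proof.
move=> gP; split; apply: within_measurable; first by case: gP.
by apply: hardy_mean_continuous; exact: profile_integrable gP.
Qed.

Lemma measurable_fun_powR (R : realType) (r : R) (h : R -> R) :
  measurable_fun (`]0, 1] : set R) h ->
  measurable_fun (`]0, 1] : set R) (fun t => h t `^ r).
Proof. by move=> mh; apply: (measurableT_comp (measurable_powR r)). Qed.

Lemma profile_integrableX (R : realType) (p f F : R) (g : R -> R) :
  monotone_profile p f F g ->
  (@lebesgue_measure R).-integrable (`]0, 1] : set R)
    (EFin \o (fun t => g t `^ p)).
Proof.
move=> gP; have [mg _] := profile_measurable _ _ _ _ _ gP.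
case: gP => g0 _ cg _ igp; apply: (@ge0_integrable_itv_oc _ F).
- exact: measurable_fun_powR.
- by move=> t _; exact: powR_ge0.
- by rewrite igp.
Qed.

Lemma profile_hardy_mean1 (R : realType) (p f F : R) (g : R -> R) :
  monotone_profile p f F g -> hardy_mean g 1 = f.
Proof.
by case=> _ _ _ ig _; rewrite /hardy_mean invr1 mul1r /Rintegral ig.
Qed.

Lemma integrable_itv_cst (R : realType) (a b k : R) :
  (@lebesgue_measure R).-integrable (`]a, b] : set R) (EFin \o cst k).
Proof.
have sub : (`]a, b] : set R) `<=` `[a, b] by exact: subset_itv_oc_cc.
have ik : (@lebesgue_measure R).-integrable (`[a, b] : set R) (EFin \o cst k).
  apply: continuous_compact_integrable; first exact: segment_compact.
  by apply: continuous_subspaceT => x; exact: cvg_cst.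
by apply: integrableS ik.
Qed.

(** By monotonicity [g t] is the least value of [g] on []0, t]], hence at most the mean there. *)
Lemma profile_le_hardy_mean (R : realType) (p f F t : R) (g : R -> R) :
  monotone_profile p f F g -> 0 < t <= 1 -> g t <= hardy_mean g t.
Proof.
move=> gP /andP[t0 t1]; have ig := profile_integrable _ _ _ _ _ gP.
have [g0 gd _ _ _] := gP.
rewrite /hardy_mean mulrC ler_pdivlMr//.
have sub : (`]0, t] : set R) `<=` `]0, 1].
  by apply: subset_itvl; rewrite bnd_simp.
have -> : g t * t = \int[@lebesgue_measure R]_(u in `]0, t]) (g t).
  rewrite Rintegral_cst//= lebesgue_measure_itv/= lte_fin t0.
  by rewrite oppr0 adde0.
apply: le_Rintegral => //.
- exact: integrable_itv_cst.
- by apply: integrableS ig.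
- by move=> u /=; rewrite in_itv/= => /andP[u0 ut]; exact: gd.
Qed.

(** Splitting at [t], [f] is at most [t * hardy_mean g t + (1 - t) * g t], and [g t] is at most the
    mean. This makes Hardy means strictly positive when [f] is, so that their real powers can be
    differentiated. *)
Lemma profile_hardy_mean_ge (R : realType) (p f F t : R) (g : R -> R) :
  monotone_profile p f F g -> 0 < t <= 1 -> f <= hardy_mean g t.
Proof.
move=> gP /[dup] t01 /andP[t0 t1]; have ig := profile_integrable _ _ _ _ _ gP.
have [g0 gd _ _ _] := gP.
have gG := profile_le_hardy_mean _ _ _ _ _ _ gP t01.
rewrite -(profile_hardy_mean1 _ _ _ _ _ gP) {1}/hardy_mean invr1 mul1r.
have := @Rintegral_itvB R g (BRight 0) (BRight 1) t ig.
rewrite !bnd_simp t1 => /(_ (ltW t0) isT).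
have sub : (`]t, 1] : set R) `<=` `]0, 1].
  by apply: subset_itvr; rewrite bnd_simp ltW.
have : \int[@lebesgue_measure R]_(u in `]t, 1]) g u <= g t * (1 - t).
  have -> : g t * (1 - t) = \int[@lebesgue_measure R]_(u in `]t, 1]) (g t).
    rewrite Rintegral_cst//= lebesgue_measure_itv/= lte_fin.
    (* The measure formula tests [t < 1]; otherwise [t = 1] and both sides vanish. *)
    case: ifPn => [//|]; rewrite -leNgt => t1'.
    by rewrite (@le_anti _ _ 1 t) ?subrr// t1' t1.
  apply: le_Rintegral => //.
  - by apply: integrableS ig.
  - exact: integrable_itv_cst.
  - move=> u /=; rewrite in_itv/= => /andP[tu u1]; apply: gd => //; exact: ltW.
rewrite -(mulr_hardy_mean _ g t t0).
set I := Rintegral _ _ _; set J := Rintegral _ _ _ => H1 H2.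
have : (1 - t) * g t <= (1 - t) * hardy_mean g t by rewrite ler_wpM2l// subr_ge0.
lra.
Qed.

(* The last equation is [Hfun p c = f `^ p / F], that is [c = omega p (f `^ p / F)]:
   [Hfun p c] factors as [c `^ (p - 1) * (p - (p - 1) * c)]. *)
Definition critical {R : realType} (p f F c : R) : Prop :=
  [/\ 1 < p, 0 < f /\ 0 < F, 1 <= c, 0 < p - (p - 1) * c &
      f `^ p = F * (c `^ (p - 1) * (p - (p - 1) * c))].

(** * The critical constant and the integrals of the extremal function *)

(** The critical equation divided by [c^(p-1)]. It relates the tangent coefficient [(f / c)^(p-1)]
    to [p - (p - 1) * c] in both stability estimates. *)
Lemma critical_scaling (R : realType) (p f F c : R) : critical p f F c ->
  (f / c) `^ (p - 1) * f = (p - (p - 1) * c) * F.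
Proof.
case=> p1 [f0 F0] c1 k0 fE; have c0 : 0 < c by lra.
have -> : (f / c) `^ (p - 1) = f `^ (p - 1) / c `^ (p - 1).
  rewrite powRM ?invr_ge0 ?(ltW f0) ?(ltW c0)//; congr (_ * _).
  by rewrite -[c^-1]powR_inv1 ?(ltW c0)// -powRrM mulN1r powRN.
rewrite mulrAC (mulrC _ f) mulr_powRB1 ?(ltW f0)//; last by lra.
by rewrite fE; field; rewrite gt_eqF// powR_gt0.
Qed.

(** The integrand is [t^(-b)] with [b = p * (1 - 1 / c)], and [1 - b = (p - (p - 1) * c) / c]: the
    positivity condition in [critical] is exactly integrability. *)
Lemma integral_powRXn (R : realType) (p f F c : R) : critical p f F c ->
  (\int[@lebesgue_measure R]_(t in `]0%R, 1%R]) ((t `^ (c^-1 - 1)) `^ p)%:E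
    = (c / (p - (p - 1) * c))%:E)%E.
Proof.
case=> p1 [f0 F0] c1 k0 fE.
have c0 : 0 < c by lra.
have b1 : p * (1 - c^-1) < 1.
  rewrite -subr_gt0 (_ : _ - _ = (p - (p - 1) * c) / c) ?divr_gt0//.
  by field; rewrite gt_eqF.
rewrite -[in RHS]invf_div (_ : (p - (p - 1) * c) / c = 1 - p * (1 - c^-1)); last first.
  by field; rewrite gt_eqF.
rewrite -(integral_powRN _ _ b1); apply: eq_integral => t _.
by rewrite -powRrM; congr (_ `^ _)%:E; ring.
Qed.

Lemma integral_extremalX (R : realType) (p f F c : R) : critical p f F c ->
  (\int[@lebesgue_measure R]_(t in `]0%R, 1%R])
     ((f / c * t `^ (c^-1 - 1)) `^ p)%:E = F%:E)%E.
Proof.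
move=> cr; have [p1 [f0 F0] c1 k0 fE] := cr.
have c0 : 0 < c by lra.
have fc0 : 0 <= f / c by rewrite divr_ge0 ?ltW.
have mv : measurable_fun (`]0, 1] : set R)
    (fun t : R => (t `^ (c^-1 - 1)) `^ p).
  exact: measurable_fun_powR (within_measurable _ _ (within_powR_id _ _)).
transitivity (((f / c) `^ p)%:E * \int[@lebesgue_measure R]_(t in `]0%R, 1%R])
    ((t `^ (c^-1 - 1)) `^ p)%:E)%E; last first.
  rewrite (integral_powRXn _ _ _ _ _ cr) -EFinM; congr (_%:E).
  rewrite powRM ?invr_ge0 ?(ltW f0) ?(ltW c0)// fE.
  rewrite -[c^-1]powR_inv1 ?(ltW c0)// -powRrM mulN1r powRN.
  rewrite -(@mulr_powRB1 _ c p) ?(ltW c0)//; last by lra.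
  by field; rewrite !gt_eqF// powR_gt0.
rewrite -ge0_integralZl_EFin ?powR_ge0//.
- by apply: eq_integral => t _; rewrite powRM ?powR_ge0// EFinM.
- by move=> t _; rewrite lee_fin powR_ge0.
- exact/measurable_EFinP.
Qed.

(** * Hardy's inequality for monotone profiles *)

Lemma profile_deficit_le (R : realType) (p f F s : R) (g : R -> R) :
  1 < p -> 0 < f -> 1 <= s -> monotone_profile p f F g ->
  (\int[@lebesgue_measure R]_(t in `]0%R, 1%R])
     (s `^ p * g t `^ p + (p - 1) * s * hardy_mean g t `^ p
       - p * s * g t * hardy_mean g t `^ (p - 1))%:E
   <= (s `^ p * F - s * f `^ p)%:E)%E.
Proof.
move=> p1 f0 s1 gP; have [g0 _ cg _ igp] := gP.
have := @hardy_deficit_le _ p s g p1 s1 g0 cg (profile_integrable _ _ _ _ _ gP)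
  (profile_integrableX _ _ _ _ _ gP).
rewrite (profile_hardy_mean1 _ _ _ _ _ gP) /Rintegral igp /=; apply=> t t01.
exact: lt_le_trans (profile_hardy_mean_ge _ _ _ _ _ _ gP t01).
Qed.

Lemma deficit_measurable (R : realType) (p s : R) (g h : R -> R) :
  measurable_fun (`]0, 1] : set R) g -> measurable_fun (`]0, 1] : set R) h ->
  measurable_fun (`]0, 1] : set R) (fun t =>
    s `^ p * g t `^ p + (p - 1) * s * h t `^ p - p * s * g t * h t `^ (p - 1)).
Proof.
move=> mg mh.
by apply: measurable_funB; [apply: measurable_funD|]; apply: measurable_funM => //;
  try apply: measurable_funM => //; exact: measurable_fun_powR.
Qed.

Lemma bregman_measurable (R : realType) (p : R) (g h : R -> R) :
  measurable_fun (`]0, 1] : set R) g -> measurable_fun (`]0, 1] : set R) h ->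
  measurable_fun (`]0, 1] : set R) (fun t => bregman p (g t) (h t)).
Proof.
move=> mg mh; rewrite /bregman.
by apply: measurable_funB; [apply: measurable_funD|apply: measurable_funM];
  try apply: measurable_funM => //; exact: measurable_fun_powR.
Qed.

(** Nonnegativity of [bregman] lets the deficit integrand dominate [(p - 1) * (s - 1) * G^p], with
    [G] the Hardy mean. Dividing requires [s > 1], whereas [c] may equal [1]; hence the parameter
    [s] above [c]. *)
Lemma profile_hardy_le_gt (R : realType) (p f F c s : R) (g : R -> R) :
  critical p f F c -> monotone_profile p f F g -> c < s ->
  (\int[@lebesgue_measure R]_(t in `]0%R, 1%R]) (hardy_mean g t `^ p)%:E
    <= (F * s `^ p)%:E)%E.
Proof.
move=> [p1 [f0 F0] c1 k0 fE] gP cs.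
have s1 : 1 < s by lra.
have s0 : 0 < s by lra.
have [mg mG] := profile_measurable _ _ _ _ _ gP.
have [g0 _ _ _ _] := gP.
have G0 (t : R) : 0 < t <= 1 -> 0 <= hardy_mean g t.
  move=> t01; apply: le_trans (ltW f0) _.
  exact: profile_hardy_mean_ge gP t01.
have l0 : 0 < (p - 1) * (s - 1) by rewrite mulr_gt0//; lra.
have Q0 (t : R) : 0 < t <= 1 -> (p - 1) * (s - 1) * hardy_mean g t `^ p <=
   s `^ p * g t `^ p + (p - 1) * s * hardy_mean g t `^ p
       - p * s * g t * hardy_mean g t `^ (p - 1).
  move=> t01; have := @bregman_ge0 _ p (s * g t) (hardy_mean g t) p1
    (mulr_ge0 (ltW s0) (g0 t t01)) (G0 t t01).
  rewrite /bregman powRM ?(ltW s0) ?g0//; lra.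
apply: le_trans (_ : (((p - 1) * (s - 1))^-1 * (s `^ p * F - s * f `^ p) +
  0 * 0 - 0 * 0)%:E <= _)%E.
  apply: (@unit_integral_le _ _ _ _ _ _ _ _ (cst 0) (fun t =>
    s `^ p * g t `^ p + (p - 1) * s * hardy_mean g t `^ p
       - p * s * g t * hardy_mean g t `^ (p - 1)) (cst 0)) => //.
  - by rewrite invr_ge0 ltW.
  - exact: measurable_fun_powR.
  - exact: deficit_measurable.
  - move=> t t01; split=> //; first exact: powR_ge0.
    by apply: le_trans (Q0 t t01); rewrite mulr_ge0 ?powR_ge0// ltW.
  - move=> t t01; rewrite /= !mulr0 !addr0 mulrC ler_pdivlMr// mulrC.
    exact: Q0.
  - by rewrite integral0.
  - by apply: (profile_deficit_le _ p f F s g) => //; exact: ltW.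
  - by rewrite integral0.
rewrite !mul0r addr0 subr0 lee_fin mulrC ler_pdivrMr//.
(* What remains amounts to [Hfun p s <= Hfun p c]. The tangent inequality gives [(p - 1) * (s * S -
   c * C) >= p * c * (S - C)], and [1 <= c] concludes. *)
have := @bregman_ge0 _ p c s p1 _ _; rewrite /bregman.
rewrite fE -!(@mulr_powRB1 _ s p) -?(@mulr_powRB1 _ c p); [|lra..].
set S := s `^ _; set C := c `^ _ => /(_ _ _)/wrap[|| H]; [lra|lra|].
have CS : C <= S by rewrite ge0_ler_powR ?nnegrE; lra.
suff : 0 <= F * s * ((p - 1) * (s * S - c * C) - p * (S - C)) by lra.
rewrite !mulr_ge0//; [lra|lra|].
have := mulr_ge0 (_ : 0 <= p * (c - 1)) (_ : 0 <= S - C) => /(_ _ _)/wrap[||]; last lra.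
- by rewrite mulr_ge0; lra.
- lra.
Qed.

(** The bound of [profile_hardy_le_gt] passes to the limit as [s] decreases to [c], which covers
    [c = 1]. *)
Lemma profile_hardy_le (R : realType) (p f F c : R) (g : R -> R) :
  critical p f F c -> monotone_profile p f F g ->
  (\int[@lebesgue_measure R]_(t in `]0%R, 1%R]) (hardy_mean g t `^ p)%:E
    <= (F * c `^ p)%:E)%E.
Proof.
move=> cr gP; have [p1 [f0 F0] c1 k0 fE] := cr.
have L : (F * s `^ p)%:E @[s --> c^'+] --> (F * c `^ p)%:E.
  apply: cvg_EFin; first exact: nearW.
  apply: cvgM; first exact: cvg_cst.
  apply: cvg_at_right_filter; apply: powR_continuous_gt0; lra.
apply: (cvge_to_ge L); near=> s.
by apply: profile_hardy_le_gt cr gP _; near: s; exact: nbhs_right_gt.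
Unshelve. all: by end_near. Qed.

(** * The weighted moment of a profile *)

Lemma integral_itv_oc_EFin (R : realType) (h : R -> R) :
  (@lebesgue_measure R).-integrable (`]0, 1] : set R) (EFin \o h) ->
  (\int[@lebesgue_measure R]_(t in `]0%R, 1%R]) (h t)%:E
    = (\int[@lebesgue_measure R]_(t in `]0%R, 1%R]) (h t))%R%:E)%E.
Proof. by move=> ih; rewrite integral_EFin. Qed.

(** The weight is [t^(-a)], proportional to the power [p - 1] of the extremal function. A single
    real [M] thus records the moment of the profile and, through [integral_weighted_hardy_mean],
    that of its Hardy mean. *)
Lemma profile_moment (R : realType) (p f F c : R) (g : R -> R) :
  critical p f F c -> monotone_profile p f F g ->
  let a := (p - 1) * (1 - c^-1) in
  exists M : R,
    (\int[@lebesgue_measure R]_(t in `]0%R, 1%R])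
       ((t `^ (c^-1 - 1)) `^ (p - 1) * g t)%:E = M%:E)%E /\
    (\int[@lebesgue_measure R]_(t in `]0%R, 1%R])
       (a * ((t `^ (c^-1 - 1)) `^ (p - 1) * hardy_mean g t))%:E
         = (M - f)%:E)%E.
Proof.
move=> cr gP a; have [p1 [f0 F0] c1 k0 fE] := cr.
have [g0 _ cg ig igp] := gP; have [mg _] := profile_measurable _ _ _ _ _ gP.
have a0 : 0 <= a.
  by rewrite mulr_ge0 ?subr_ge0 ?invf_le1//; lra.
have vE (t : R) : (t `^ (c^-1 - 1)) `^ (p - 1) = t `^ (- a).
  by rewrite -powRrM; congr (_ `^ _); rewrite /a; ring.
have mv : measurable_fun (`]0, 1] : set R) (fun t : R => t `^ (c^-1 - 1)).
  exact: within_measurable (within_powR_id _ _).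
have wg0 (t : R) : 0 < t <= 1 -> 0 <= t `^ (- a) * g t.
  by move=> t01; rewrite mulr_ge0 ?powR_ge0 ?g0.
have mwg : measurable_fun (`]0, 1] : set R) (fun t : R => t `^ (- a) * g t).
  by apply: measurable_funM => //; exact: within_measurable (within_powR_id _ _).
have iwg : (@lebesgue_measure R).-integrable (`]0, 1] : set R)
    (EFin \o (fun t => t `^ (- a) * g t)).
  (* The constant is the one of [powRB1_mul_le] with [e = 1], using the integrals of the powers [p]
     of [t^(1/c-1)] and of [g]. *)
  apply: (@ge0_integrable_itv_oc _
    (1 * (c / (p - (p - 1) * c)) + 1 `^ (1 - p) * F - 0 * 0)) => //.
  apply: (@unit_integral_le _ _ _ _ _ _ _ _ (cst 0)
    (fun t => (t `^ (c^-1 - 1)) `^ p) (fun t => g t `^ p)) => //.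
  - exact: measurable_fun_powR.
  - exact: measurable_fun_powR.
  - by move=> t t01; split; rewrite ?powR_ge0 ?wg0.
  - move=> t t01; rewrite mul0r addr0 -vE.
    by apply: powRB1_mul_le; rewrite ?powR_ge0 ?g0.
  - by rewrite integral0.
  - by rewrite (integral_powRXn _ _ _ _ _ cr).
  - by rewrite igp.
exists (\int[@lebesgue_measure R]_(t in `]0, 1]) (t `^ (- a) * g t)); split.
  transitivity (\int[@lebesgue_measure R]_(t in `]0%R, 1%R])
      (t `^ (- a) * g t)%:E)%E; last exact: integral_itv_oc_EFin.
  by apply: eq_integral => t _; rewrite vE.
rewrite -(profile_hardy_mean1 _ _ _ _ _ gP).
transitivity (\int[@lebesgue_measure R]_(t in `]0%R, 1%R])
    (a * (t `^ (- a) * hardy_mean g t))%:E)%E.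
  by apply: eq_integral => t _; rewrite vE.
by apply: integral_weighted_hardy_mean => //; exact: profile_integrable gP.
Qed.

(** * The two stability estimates *)

(** The gap controls successively the divergence of [c * g] from its Hardy mean, their distance in
    [L^p], the weighted [L^1] distance, the moment, and the divergence of [g] from the extremal
    function. Each use of coercivity or of [powRB1_mul_le] costs a small additive error, whence the
    affine form of the bound. *)
Lemma extremal_distance_le (R : realType) (p f F c e : R) :
  critical p f F c -> 0 < e ->
  exists2 K : R, 0 < K & forall (g : R -> R) (J : R),
    monotone_profile p f F g ->
    (\int[@lebesgue_measure R]_(t in `]0%R, 1%R])
       (hardy_mean g t `^ p)%:E = J%:E)%E ->
    (\int[@lebesgue_measure R]_(t in `]0%R, 1%R])
       (`|g t - f / c * t `^ (c^-1 - 1)| `^ p)%:E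
      <= (e + K * (F * c `^ p - J))%:E)%E.
Proof.
move=> cr e0; have [p1 [f0 F0] c1 k0 fE] := cr.
set kap := p - (p - 1) * c in k0 fE.
have c0 : 0 < c by lra.
have p0 : 0 <= p by lra.
have pc0 : 0 <= (p - 1) * (c - 1) by rewrite mulr_ge0//; lra.
have fc0 : 0 <= f / c by rewrite divr_ge0 ?ltW.
pose a := (p - 1) * (1 - c^-1); pose V := c / kap.
pose k := (f / c) `^ (p - 1).
have a0 : 0 <= a.
  by rewrite mulr_ge0 ?subr_ge0 ?invf_le1//; lra.
have V0 : 0 < V by rewrite divr_gt0.
have k_gt0 : 0 < k by rewrite powR_gt0// divr_gt0.
have ac : a * c = 1 - kap by rewrite /a /kap; field; rewrite gt_eqF.
have kf : k * f = kap * F by exact: critical_scaling cr.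
(* The extremal function has [p]-th power integral [F], so this choice spends [e / 2] of the error
   budget. *)
have [K1 K10 cK1] := bregman_coercive _ p (e / (2 * F)) p1
  (divr_gt0 e0 (mulr_gt0 (ltr0n _ 2) F0)).
(* The factor with which the moment error [y2] enters the final bound. *)
pose A1 := K1 * (p * k * a / kap).
have A10 : 0 <= A1.
  have ka0 := mulr_ge0 (mulr_ge0 p0 (ltW k_gt0)) a0.
  exact: mulr_ge0 (ltW K10) (divr_ge0 ka0 (ltW k0)).
(* [eta] and [e2] are chosen to cost at most [e / 4] each. The denominators use [A1 + 1] because
   [A1] vanishes for [c = 1]. *)
pose eta := e / (4 * (A1 + 1) * V).
have A1p : 0 < A1 + 1 by rewrite ltr_wpDl.
have A4 : 0 < 4 * (A1 + 1) := mulr_gt0 (ltr0n _ 4) A1p.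
have eta0 : 0 < eta by exact: divr_gt0 e0 (mulr_gt0 A4 V0).
pose X := eta `^ (1 - p).
have X0 : 0 < X by rewrite powR_gt0.
have cp0 : 0 < c `^ p by rewrite powR_gt0.
pose e2 := e / (4 * (A1 + 1) * X * (F * c `^ p)).
have e20 : 0 < e2.
  exact: divr_gt0 e0 (mulr_gt0 (mulr_gt0 A4 X0) (mulr_gt0 F0 cp0)).
have [K2 K20 cK2] := bregman_coercive _ p e2 p1 e20.
exists (A1 * (X * (K2 * ((p - 1) * (c - 1)))) + 1).
  rewrite ltr_wpDl//.
  exact: mulr_ge0 A10 (mulr_ge0 (ltW X0) (mulr_ge0 (ltW K20) pc0)).
move=> g J gP GJ; have [g0 _ cg ig igp] := gP.
have [mg mG] := profile_measurable _ _ _ _ _ gP.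
have G0 (t : R) : 0 < t <= 1 -> 0 <= hardy_mean g t.
  move=> t01; apply: le_trans (ltW f0) _.
  exact: profile_hardy_mean_ge gP t01.
have [M [gM GM]] := profile_moment _ _ _ _ _ _ cr gP.
rewrite -/a in GM.
pose v (t : R) := t `^ (c^-1 - 1).
have v0 t : 0 <= v t by exact: powR_ge0.
have mv : measurable_fun (`]0, 1] : set R) v.
  exact: within_measurable (within_powR_id _ _).
have mV r : measurable_fun (`]0, 1] : set R) (fun t => v t `^ r).
  exact: measurable_fun_powR.
have x0 t : 0 <= f / c * v t by exact: mulr_ge0.
have mx : measurable_fun (`]0, 1] : set R) (fun t => f / c * v t).
  exact: measurable_funM.
have mcg : measurable_fun (`]0, 1] : set R) (fun t => c * g t).
  exact: measurable_funM.
have mdif (u w : R -> R) : measurable_fun (`]0, 1] : set R) u ->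
    measurable_fun (`]0, 1] : set R) w ->
    measurable_fun (`]0, 1] : set R) (fun t => `|u t - w t|).
  move=> mu mw; apply: (measurableT_comp (@normr_measurable R setT)).
  exact: measurable_funB.
have J_le : J <= F * c `^ p.
  by rewrite -lee_fin -GJ; exact: profile_hardy_le cr gP.
pose d := F * c `^ p - J; have d0 : 0 <= d by rewrite subr_ge0.
have QE (t : R) : 0 < t <= 1 ->
    c `^ p * g t `^ p + (p - 1) * c * hardy_mean g t `^ p
       - p * c * g t * hardy_mean g t `^ (p - 1)
    = bregman p (c * g t) (hardy_mean g t)
      + (p - 1) * (c - 1) * hardy_mean g t `^ p.
  by move=> t01; rewrite /bregman powRM ?(ltW c0) ?g0//; ring.
have D0 (t : R) : 0 < t <= 1 -> 0 <= bregman p (c * g t) (hardy_mean g t).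
  by move=> t01; apply: bregman_ge0; rewrite ?G0// mulr_ge0 ?g0// ltW.
(* By the critical equation [c^p * F - c * f^p] equals [(p - 1) * (c - 1) * F * c^p], which makes
   the deficit proportional to the gap [d]. *)
have D1 : (\int[@lebesgue_measure R]_(t in `]0%R, 1%R])
    (bregman p (c * g t) (hardy_mean g t))%:E
      <= ((p - 1) * (c - 1) * d)%:E)%E.
  apply: (le_trans (@unit_integral_le _ ((p - 1) * (c - 1)) 1 0
    (c `^ p * F - c * f `^ p) 0 J _
    (fun t => hardy_mean g t `^ p) (fun t =>
    c `^ p * g t `^ p + (p - 1) * c * hardy_mean g t `^ p
       - p * c * g t * hardy_mean g t `^ (p - 1)) (cst 0) _ _ _ _ _ _ _ _ _ _ _ _)) => //.
  - exact: bregman_measurable.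
  - exact: measurable_fun_powR.
  - exact: deficit_measurable.
  - move=> t t01; split; rewrite ?powR_ge0 ?D0// QE//.
    exact: addr_ge0 (D0 t t01) (mulr_ge0 pc0 (powR_ge0 _ _)).
  - by move=> t t01; rewrite QE// mul1r mul0r addr0.
  - by rewrite GJ.
  - by apply: profile_deficit_le.
  - by rewrite integral0.
  - rewrite lee_fin fE /d -(@mulr_powRB1 _ c p) ?(ltW c0)//; last lra.
    set C := c `^ (p - 1); rewrite /kap.
    by rewrite le_eqVlt; apply/orP; left; apply/eqP; ring.
have E1 : (\int[@lebesgue_measure R]_(t in `]0%R, 1%R])
    (`|c * g t - hardy_mean g t| `^ p)%:E
      <= (e2 * J + K2 * ((p - 1) * (c - 1) * d) - 0 * 0)%:E)%E.
  apply: (@unit_integral_le _ _ _ _ _ _ _ _ (cst 0)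
    (fun t => hardy_mean g t `^ p)
    (fun t => bregman p (c * g t) (hardy_mean g t))) => //.
  - exact: ltW.
  - exact: ltW.
  - by apply: measurable_fun_powR; exact: mdif.
  - exact: measurable_fun_powR.
  - exact: bregman_measurable.
  - by move=> t t01; split; rewrite ?powR_ge0 ?D0.
  - move=> t t01; rewrite mul0r addr0; apply: cK2; rewrite ?G0//.
    by rewrite mulr_ge0 ?g0// ltW.
  - by rewrite integral0.
  - by rewrite GJ.
set y1 := _ - 0 * 0 in E1.
have E2 : (\int[@lebesgue_measure R]_(t in `]0%R, 1%R])
    (v t `^ (p - 1) * `|c * g t - hardy_mean g t|)%:E
      <= (eta * V + X * y1 - 0 * 0)%:E)%E.
  apply: (@unit_integral_le _ _ _ _ _ _ _ _ (cst 0)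
    (fun t => v t `^ p)
    (fun t => `|c * g t - hardy_mean g t| `^ p)) => //.
  - exact: ltW.
  - exact: ltW.
  - by apply: measurable_funM => //; exact: mdif.
  - by apply: measurable_fun_powR; exact: mdif.
  - by move=> t t01; split; rewrite ?mulr_ge0 ?powR_ge0.
  - by move=> t t01; rewrite mul0r addr0; exact: powRB1_mul_le.
  - by rewrite integral0.
  - by rewrite (integral_powRXn _ _ _ _ _ cr).
set y2 := _ - 0 * 0 in E2.
(* Integrating [c * g <= G + |c * g - G|] against [a] times the weight gives
   [a * c * M <= M - f + a * y2], and [a * c = 1 - kap]. *)
have ME : f <= kap * M + a * y2.
  have := @unit_integral_le _ (a * c) 1 a (M - f) y2 M (cst 0)
    (fun t => v t `^ (p - 1) * g t)
    (fun t => a * (v t `^ (p - 1) * hardy_mean g t))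
    (fun t => v t `^ (p - 1) * `|c * g t - hardy_mean g t|).
  rewrite integral0 lee_fin ac => /(_ _ _ _ _ _ _ _ _ _ _ _ _)/wrap[]//.
  - by rewrite -ac mulr_ge0// ltW.
  - exact: measurable_funM.
  - by apply: measurable_funM => //; apply: measurable_funM.
  - by apply: measurable_funM => //; exact: mdif.
  - move=> t t01; split=> //.
    + exact: mulr_ge0 (powR_ge0 _ _) (g0 t t01).
    + exact: mulr_ge0 a0 (mulr_ge0 (powR_ge0 _ _) (G0 t t01)).
    + exact: mulr_ge0 (powR_ge0 _ _) (normr_ge0 _).
  - move=> t t01; rewrite -ac add0r mul1r -mulrDr -mulrA ler_wpM2l//.
    rewrite mulrCA -mulrDr ler_wpM2l ?powR_ge0// addrC -lerBlDr.
    exact: ler_norm.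
  - by rewrite gM.
  - by rewrite GM.
  - by lra.
have D2 : (\int[@lebesgue_measure R]_(t in `]0%R, 1%R])
    (bregman p (g t) (f / c * v t))%:E
      <= (1 * F + (p - 1) * F - p * k * M)%:E)%E.
  apply: (@unit_integral_le _ _ _ _ _ _ _ _ (fun t => v t `^ (p - 1) * g t)
    (fun t => g t `^ p)
    (fun t => (f / c * v t) `^ p)) => //.
  - by rewrite mulr_ge0 ?(ltW k_gt0)//; lra.
  - by lra.
  - exact: bregman_measurable.
  - exact: measurable_funM.
  - exact: measurable_fun_powR.
  - exact: measurable_fun_powR.
  - move=> t t01; split; rewrite ?powR_ge0//.
      exact: bregman_ge0 p1 (g0 t t01) (x0 t).
    exact: mulr_ge0 (powR_ge0 _ _) (g0 t t01).
  - move=> t t01; rewrite /bregman (@powRM _ (f / c) (v t) (p - 1))// -/k.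
    rewrite le_eqVlt; apply/orP; left; apply/eqP; ring.
  - by rewrite gM.
  - by rewrite igp.
  - by rewrite (integral_extremalX _ _ _ _ _ cr).
apply: (le_trans (@unit_integral_le _ 0 (e / (2 * F)) K1 F
   (1 * F + (p - 1) * F - p * k * M) 0 _ (cst 0)
    (fun t => (f / c * v t) `^ p)
    (fun t => bregman p (g t) (f / c * v t)) _ _ _ _ _ _ _ _ _ _ _ _)) => //.
- by rewrite divr_ge0 ?mulr_ge0 ?(ltW F0) ?(ltW e0).
- exact: ltW.
- by apply: measurable_fun_powR; exact: mdif.
- exact: measurable_fun_powR.
- exact: bregman_measurable.
- move=> t t01; split=> //; try exact: powR_ge0.
  exact: bregman_ge0 p1 (g0 t t01) (x0 t).
- by move=> t t01; rewrite mul0r addr0; apply: cK1; rewrite ?g0 ?x0.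
- by rewrite integral0.
- by rewrite (integral_extremalX _ _ _ _ _ cr).
rewrite lee_fin -/d mulr0 subr0.
have -> : e / (2 * F) * F = e / 2 by field; rewrite gt_eqF.
(* The lower bound [ME] on the moment, multiplied by [k] and combined with [k * f = kap * F], bounds
   the divergence from the extremal function. *)
have B1 : K1 * (1 * F + (p - 1) * F - p * k * M) <= A1 * y2.
  have : kap * F <= k * (kap * M + a * y2) by rewrite -kf ler_wpM2l// ltW.
  have K1p : 0 <= K1 * p / kap.
    exact: divr_ge0 (mulr_ge0 (ltW K10) p0) (ltW k0).
  move=> /(ler_wpM2l K1p).
  have -> : K1 * p / kap * (kap * F) = K1 * (p * F) by field; rewrite gt_eqF.
  have -> : K1 * p / kap * (k * (kap * M + a * y2)) = K1 * (p * k * M) + A1 * y2.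
    by rewrite /A1; field; rewrite gt_eqF.
  lra.
have A1e : A1 / (A1 + 1) * (e / 4) <= e / 4.
  rewrite -[leRHS]mul1r ler_wpM2r//; first by rewrite divr_ge0// ltW.
  by rewrite ler_pdivrMr// mul1r lerDl.
have B2 : A1 * (eta * V) <= e / 4.
  rewrite (_ : A1 * (eta * V) = A1 / (A1 + 1) * (e / 4))//.
  by rewrite /eta; field; rewrite !gt_eqF.
have B3 : A1 * (X * (e2 * J)) <= e / 4.
  have : A1 * (X * (e2 * J)) <= A1 * (X * (e2 * (F * c `^ p))).
    by rewrite ler_wpM2l// ler_wpM2l ?(ltW X0)// ler_wpM2l// ltW.
  have -> : A1 * (X * (e2 * (F * c `^ p))) = A1 / (A1 + 1) * (e / 4).
    by rewrite /e2; field; rewrite !gt_eqF.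
  by move=> /le_trans; apply.
rewrite /y2 /y1 in B1; lra.
Qed.

(** The distance to the extremal function bounds the moment from below, hence that of the Hardy
    mean. The tangent to [z^p] at [c] times the extremal function, which is the Hardy mean of the
    latter, turns this into a lower bound on [J]. *)
Lemma hardy_gap_le (R : realType) (p f F c e : R) :
  critical p f F c -> 0 < e ->
  exists2 K : R, 0 < K & forall (g : R -> R) (J x : R),
    monotone_profile p f F g ->
    (\int[@lebesgue_measure R]_(t in `]0%R, 1%R])
       (hardy_mean g t `^ p)%:E = J%:E)%E ->
    (\int[@lebesgue_measure R]_(t in `]0%R, 1%R])
       (`|g t - f / c * t `^ (c^-1 - 1)| `^ p)%:E <= x%:E)%E ->
    F * c `^ p - J <= e + K * x.
Proof.
move=> cr e0; have [p1 [f0 F0] c1 k0 fE] := cr.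
set kap := p - (p - 1) * c in k0 fE.
have c0 : 0 < c by lra.
have p0 : 0 <= p by lra.
have fc0 : 0 <= f / c by rewrite divr_ge0 ?ltW.
(* For [c = 1] the exponent [a] is zero and cannot be divided by, but then [g <= hardy_mean g]
   already gives [F <= J]. *)
move: c1; rewrite le_eqVlt => /predU1P[c1|c1].
  exists 1 => // g J x gP GJ xle; have [g0 _ _ _ igp] := gP.
  have [mg mG] := profile_measurable _ _ _ _ _ gP.
  have x0 : 0 <= x.
    rewrite -lee_fin; apply: le_trans xle; apply: integral_ge0 => t _.
    by rewrite lee_fin powR_ge0.
  suff : F <= J by rewrite -c1 powR1; lra.
  rewrite -lee_fin -GJ -igp; apply: ge0_le_integral => //.
  - by move=> t _; rewrite lee_fin powR_ge0.
  - by apply/measurable_EFinP; exact: measurable_fun_powR.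
  - by apply/measurable_EFinP; exact: measurable_fun_powR.
  move=> t; rewrite /= in_itv/= => t01; rewrite lee_fin.
  have gG := profile_le_hardy_mean _ _ _ _ _ _ gP t01.
  rewrite ge0_ler_powR ?nnegrE ?g0//.
  exact: le_trans (g0 t t01) gG.
pose a := (p - 1) * (1 - c^-1); pose V := c / kap.
pose k := (f / c) `^ (p - 1).
have a0 : 0 < a.
  by rewrite mulr_gt0 ?subr_gt0 ?invf_lt1//; lra.
have V0 : 0 < V by rewrite divr_gt0.
have k_gt0 : 0 < k by rewrite powR_gt0// divr_gt0.
have ac : a * c = 1 - kap by rewrite /a /kap; field; rewrite gt_eqF.
have kf : k * f = kap * F by exact: critical_scaling cr.

have cp0 : 0 < c `^ (p - 1) by rewrite powR_gt0.
(* [p * c^(p-1) * k] is the coefficient in the tangent inequality; the division by [a] matches the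
   second identity of [profile_moment]. *)
pose L := p * c `^ (p - 1) * k / a.
have L0 : 0 < L by rewrite divr_gt0// !mulr_gt0//; lra.
pose eta := e / (L * V).
have eta0 : 0 < eta by exact: divr_gt0 e0 (mulr_gt0 L0 V0).
pose X := eta `^ (1 - p).
have X0 : 0 < X by rewrite powR_gt0.
exists (L * X); first exact: mulr_gt0.
move=> g J x gP GJ xle; have [g0 _ cg ig igp] := gP.
have [mg mG] := profile_measurable _ _ _ _ _ gP.
have G0 (t : R) : 0 < t <= 1 -> 0 <= hardy_mean g t.
  move=> t01; apply: le_trans (ltW f0) _.
  exact: profile_hardy_mean_ge gP t01.
have [M [gM GM]] := profile_moment _ _ _ _ _ _ cr gP.
rewrite -/a in GM.
pose v (t : R) := t `^ (c^-1 - 1).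
have v0 t : 0 <= v t by exact: powR_ge0.
have mv : measurable_fun (`]0, 1] : set R) v.
  exact: within_measurable (within_powR_id _ _).
have mV r : measurable_fun (`]0, 1] : set R) (fun t => v t `^ r).
  exact: measurable_fun_powR.
have x0 t : 0 <= f / c * v t by exact: mulr_ge0.
have mx : measurable_fun (`]0, 1] : set R) (fun t => f / c * v t).
  exact: measurable_funM.
have mdif : measurable_fun (`]0, 1] : set R) (fun t => `|g t - f / c * v t|).
  apply: (measurableT_comp (@normr_measurable R setT)).
  exact: measurable_funB.
have E2 : (\int[@lebesgue_measure R]_(t in `]0%R, 1%R])
    (v t `^ (p - 1) * `|g t - f / c * v t|)%:E
      <= (eta * V + X * x - 0 * 0)%:E)%E.
  apply: (@unit_integral_le _ _ _ _ _ _ _ _ (cst 0)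
    (fun t => v t `^ p)
    (fun t => `|g t - f / c * v t| `^ p)) => //.
  - exact: ltW.
  - exact: ltW.
  - exact: measurable_funM.
  - exact: measurable_fun_powR.
  - by move=> t t01; split; rewrite ?mulr_ge0 ?powR_ge0.
  - by move=> t t01; rewrite mul0r addr0; exact: powRB1_mul_le.
  - by rewrite integral0.
  - by rewrite (integral_powRXn _ _ _ _ _ cr).
set y := _ - 0 * 0 in E2.
(* [f / kap] is the moment of the extremal function. *)
have M_ge : f / kap <= M + y.
  have := @unit_integral_le _ (f / c) 1 1 M y V (cst 0)
    (fun t => v t `^ p) (fun t => v t `^ (p - 1) * g t)
    (fun t => v t `^ (p - 1) * `|g t - f / c * v t|).
  rewrite integral0 lee_fin => /(_ _ _ _ _ _ _ _ _ _ _ _ _)/wrap[]//.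
  - exact: measurable_funM.
  - exact: measurable_funM.
  - move=> t t01; split=> //; try exact: powR_ge0.
      exact: mulr_ge0 (powR_ge0 _ _) (g0 t t01).
    exact: mulr_ge0 (powR_ge0 _ _) (normr_ge0 _).
  - move=> t t01; rewrite add0r !mul1r -mulrDr.
    rewrite -(@mulr_powRB1 _ (v t) p)//; last lra.
    rewrite mulrA mulrC ler_wpM2l ?powR_ge0// addrC -lerBlDr.
    by rewrite distrC; exact: ler_norm.
  - by rewrite (integral_powRXn _ _ _ _ _ cr).
  - by rewrite gM.
  have -> : f / c * V = f / kap by rewrite /V; field; rewrite !gt_eqF.
  by lra.
have J_ge : L * (M - f) <= J + (p - 1) * c `^ p * F.
  have := @unit_integral_le _ L 1 ((p - 1) * c `^ p) J F (M - f) (cst 0)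
    (fun t => a * (v t `^ (p - 1) * hardy_mean g t))
    (fun t => hardy_mean g t `^ p) (fun t => (f / c * v t) `^ p).
  rewrite integral0 lee_fin => /(_ _ _ _ _ _ _ _ _ _ _ _ _)/wrap[]//.
  - exact: ltW.
  - by rewrite mulr_ge0 ?powR_ge0//; lra.
  - by apply: measurable_funM => //; apply: measurable_funM.
  - exact: measurable_fun_powR.
  - exact: measurable_fun_powR.
  - move=> t t01; split=> //; try exact: powR_ge0.
    exact: mulr_ge0 (ltW a0) (mulr_ge0 (powR_ge0 _ _) (G0 t t01)).
  - move=> t t01; rewrite add0r mul1r.
    have := bregman_ge0 _ p _ _ p1 (G0 t t01) (mulr_ge0 (ltW c0) (x0 t)).
    rewrite /bregman !(@powRM _ c (f / c * v t)) ?(ltW c0)//.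
    rewrite (@powRM _ (f / c) (v t) (p - 1))// -/k.
    have -> : L * (a * (v t `^ (p - 1) * hardy_mean g t)) =
      p * hardy_mean g t * (c `^ (p - 1) * (k * v t `^ (p - 1))).
      by rewrite /L; field; rewrite gt_eqF.
    lra.
  - by rewrite GM.
  - by rewrite GJ.
  - by rewrite (integral_extremalX _ _ _ _ _ cr).
  by lra.
(* With this identity the tangent bound [J_ge] takes exactly the value [F * c^p] at the extremal
   moment. *)
have LF : L * (f / kap - f) = p * F * c `^ p.
  have -> : L * (f / kap - f) = p * c `^ (p - 1) * (k * f) * ((1 - kap) / kap) / a.
    by rewrite /L; field; rewrite !gt_eqF.
  rewrite kf -ac -(@mulr_powRB1 _ c p) ?(ltW c0)//; last lra.
  by field; rewrite !gt_eqF.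
have Ly : L * y = e + L * X * x.
  rewrite /y /eta mulr0 subr0; field; rewrite !gt_eqF//.
have := ler_wpM2l (ltW L0) M_ge; lra.
Qed.

(** * The value of [omega] and the passage to the limit *)

(** The intermediate value theorem makes [Hfun p] surjective onto [[0, 1]], so [pinv] returns a
    genuine preimage in [[1, q]]. Since [f^p / F] is positive, the factor [p - (p - 1) * c] is
    positive too. *)
Lemma omega_critical (R : realType) (p f F : R) :
  1 < p -> 0 < f -> f `^ p <= F -> critical p f F (omega p (f `^ p / F)).
Proof.
move=> p1 f0 fF; have fp0 : 0 < f `^ p by exact: powR_gt0.
have F0 : 0 < F by exact: lt_le_trans fF.
have q0 : 0 < p - 1 by lra.
set q := p / (p - 1).
have q1 : 1 <= q by rewrite ler_pdivlMr; lra.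
have HE z : 0 < z -> Hfun p z = z `^ (p - 1) * (p - (p - 1) * z).
  move=> z0; rewrite /Hfun -(@mulr_powRB1 _ z p) ?(ltW z0)//; last lra.
  by ring.
have Hsurj : set_surj `[1, q] `[0, 1] (Hfun p).
  move=> y /=; rewrite in_itv/= => /andP[y0 y1].
  have cH : {within `[1, q], continuous (Hfun p)}.
    apply: continuous_in_subspaceT => z; rewrite inE/= in_itv/= => /andP[z1 _].
    have z0 : 0 < z by lra.
    have cst_cont (k : R) : {for z, continuous (fun _ : R => k)} by exact: cvg_cst.
    apply: (@continuousD _ _ _ (fun z => - (p - 1) * z `^ p)
      (fun z => p * z `^ (p - 1))).
      apply: (@continuousM _ _ (fun=> - (p - 1)) (@powR R ^~ p)) => //.
      exact: powR_continuous_gt0.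
    apply: (@continuousM _ _ (fun=> p) (@powR R ^~ (p - 1))) => //.
    exact: powR_continuous_gt0.
  have H1 : Hfun p 1 = 1 by rewrite HE// powR1 mul1r mulr1; ring.
  have Hq : Hfun p q = 0.
    rewrite HE; last by lra.
    by rewrite /q mulrCA divff ?gt_eqF// mulr1 subrr mulr0.
  have [|z zq Hz] := @IVT _ (Hfun p) 1 q y q1 cH; last by exists z.
  by rewrite H1 Hq min_r// max_l// y0.
have y01 : `[0, 1]%classic (f `^ p / F).
  by rewrite /= in_itv/= divr_ge0 ?(ltW fp0) ?(ltW F0)//= ler_pdivrMr// mul1r.
set c := omega p (f `^ p / F).
have : `[1, q]%classic c.
  by apply: (@surjpinv_image_sub _ _ (fun=> point) _ _ _ Hsurj); exists (f `^ p / F).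
rewrite /= in_itv/= => /andP[c1 cq].
have c0 : 0 < c by lra.
have : Hfun p c = f `^ p / F.
  by rewrite /c /omega (@surjpK _ _ (fun=> point) _ _ _ Hsurj)// inE.
rewrite HE// => Hc.
have fE : f `^ p = F * (c `^ (p - 1) * (p - (p - 1) * c)).
  by rewrite Hc mulrC divfK// gt_eqF.
split=> //.
have : 0 < c `^ (p - 1) * (p - (p - 1) * c) by rewrite Hc divr_gt0.
by rewrite pmulr_rgt0// powR_gt0.
Qed.

(** [K] is fixed for the tolerance [e / 2] before [n] is taken large, so it may depend on [e];
    eventually [K * y n] is also at most [e / 2]. *)
Lemma cvg0_of_affine_bound (R : realType) (x y : nat -> R) :
  (forall n, 0 <= x n) ->
  (forall e : R, 0 < e -> exists2 K : R, 0 < K & forall n, x n <= e + K * y n) ->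
  y @ \oo --> (0 : R) -> x @ \oo --> (0 : R).
Proof.
move=> x0 xy /cvgrPdist_lt y0; apply/cvgrPdist_le => e e0.
have e2 : 0 < e / 2 by rewrite divr_gt0.
have [K K0 xK] := xy _ e2.
have := y0 _ (divr_gt0 e2 K0); apply: filterS => n.
rewrite !sub0r !normrN => yn; rewrite ger0_norm//.
apply: (le_trans (xK n)).
have : K * y n <= e / 2.
  rewrite mulrC -ler_pdivlMr// (le_trans (ler_norm _))//.
  exact: ltW.
lra.
Qed.

Lemma cvg_EFinP (R : realType) (x : nat -> R) (l : R) :
  (EFin \o x) @ \oo --> l%:E <-> x @ \oo --> l.
Proof.
split=> [/fine_cvgP[] //|xl].
by apply: cvg_EFin => //; exact: nearW.
Qed.

Lemma integral_fine (R : realType) (C : R) (h : R -> R) :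
  (forall t : R, 0 <= h t) ->
  (\int[@lebesgue_measure R]_(t in `]0%R, 1%R]) (h t)%:E <= C%:E)%E ->
  (\int[@lebesgue_measure R]_(t in `]0%R, 1%R]) (h t)%:E
    = (\int[@lebesgue_measure R]_(t in `]0%R, 1%R]) h t)%R%:E)%E.
Proof.
move=> h0 hC; rewrite /Rintegral fineK// ge0_fin_numE.
  exact: le_lt_trans hC (ltry C).
by apply: integral_ge0 => t _; rewrite lee_fin.
Qed.

Theorem theorem3 (R : realType) (p f F : R) (gn : nat -> R -> R)
    (hp : 1 < p) (hf : 0 < f) (hfF : f `^ p <= F)
    (gn_ge0 : forall n t, t \in `]0, 1] -> 0 <= gn n t)
    (gn_noninc : forall n s t,
      s \in `]0, 1] -> t \in `]0, 1] -> s <= t -> gn n t <= gn n s)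
    (gn_cont : forall n, {within `]0, 1], continuous (gn n)})
    (gn_int : forall n,
      (\int[@lebesgue_measure R]_(u in `]0%R, 1%R]) (gn n u)%:E = f%:E)%E)
    (gn_intp : forall n,
      (\int[@lebesgue_measure R]_(u in `]0%R, 1%R]) (gn n u `^ p)%:E = F%:E)%E) :
  (fun n => (\int[@lebesgue_measure R]_(t in `]0%R, 1%R])
      (hardy_mean (gn n) t `^ p)%:E)%E) @ \oo
    --> (F * omega p (f `^ p / F) `^ p)%:E
  <->
  (fun n => (\int[@lebesgue_measure R]_(t in `]0%R, 1%R])
      (`|gn n t - extremal p f F t| `^ p)%:E)%E) @ \oo
    --> 0%:E.
Proof.
have cr := omega_critical _ _ _ _ hp hf hfF.
rewrite /extremal; set c := omega p (f `^ p / F) in cr *.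
have gP n : monotone_profile p f F (gn n).
  split=> //.
    by move=> t t01; apply: gn_ge0; rewrite in_itv.
  move=> s t s0 st t1; apply: gn_noninc => //; rewrite in_itv/=.
    by rewrite s0 (le_trans st).
  by rewrite t1 (lt_le_trans s0).
set l := F * c `^ p.
pose J n := \int[@lebesgue_measure R]_(t in `]0%R, 1%R])
  (hardy_mean (gn n) t `^ p).
have JE n : (\int[@lebesgue_measure R]_(t in `]0%R, 1%R])
    (hardy_mean (gn n) t `^ p)%:E = (J n)%:E)%E.
  apply: (@integral_fine _ l) => [t|]; first exact: powR_ge0.
  exact: profile_hardy_le cr (gP n).
have J_le n : J n <= l.
  by rewrite -lee_fin -JE; exact: profile_hardy_le cr (gP n).
pose x n := \int[@lebesgue_measure R]_(t in `]0%R, 1%R])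
  (`|gn n t - f / c * t `^ (-1 + 1 / c)| `^ p).
have xE n : (\int[@lebesgue_measure R]_(t in `]0%R, 1%R])
    (`|gn n t - f / c * t `^ (-1 + 1 / c)| `^ p)%:E = (x n)%:E)%E.
  (* The distance is finite: the stability estimate with tolerance [1] bounds it by a real
     number. *)
  have [K _ /(_ _ _ (gP n) (JE n)) xK] :=
    extremal_distance_le _ _ _ _ _ _ cr ltr01.
  apply: integral_fine => [t|]; first exact: powR_ge0.
  by rewrite div1r addrC; exact: xK.
have x0 n : 0 <= x n.
  by apply: Rintegral_ge0 => t _; exact: powR_ge0.
rewrite (_ : (fun n => _) = EFin \o J); last by apply/funext => n; rewrite JE.
rewrite [X in _ <-> X @ _ --> _](_ : _ = EFin \o x); last first.
  by apply/funext => n; rewrite xE.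
have gap_cvg : J @ \oo --> l <-> (fun n => l - J n) @ \oo --> (0 : R).
  split=> [Jl|gl].
    by rewrite -(subrr l); apply: cvgB => //; exact: cvg_cst.
  rewrite (_ : J = (fun n => l - (l - J n))); last first.
    by apply/funext => n; rewrite subKr.
  by rewrite -[X in _ --> X]subr0; apply: cvgB => //; exact: cvg_cst.
apply: (iff_trans (cvg_EFinP _ J l)); apply: (iff_trans gap_cvg).
apply: iff_trans (iff_sym (cvg_EFinP _ x 0)); split.
- apply: (cvg0_of_affine_bound _ x (fun n => l - J n) x0) => e e0.
  have [K K0 xK] := extremal_distance_le _ _ _ _ _ _ cr e0.
  exists K => // n; rewrite -lee_fin -xE div1r addrC.
  exact: xK (gP n) (JE n).
- apply: (cvg0_of_affine_bound _ (fun n => l - J n) x) => [n|e e0].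
    by rewrite subr_ge0.
  have [K K0 gK] := hardy_gap_le _ _ _ _ _ _ cr e0.
  exists K => // n; apply: gK (gP n) (JE n) _.
  by rewrite -xE div1r addrC.
Qed.
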